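(* Let $n>k\ge 1$, let $X$ be a non-random real $n\times k$ matrix of rank $k$, $\beta\in\mathbb{R}^k$, and $Y=X\beta+\varepsilon$, where the random vector $\varepsilon\in\mathbb{R}^n$ is normally distributed with $E(\varepsilon)=0$ and $\operatorname{cov}(\varepsilon)=\sigma^2 I_n$, $\sigma^2>0$. Let $\lambda_1,\dots,\lambda_k$ be the eigenvalues of $(X^TX)^{-1}$ (with multiplicity), $\lambda_1$ being the maximum one, and let $z_1$ ($z_1^Tz_1=1$) be a normalized eigenvector corresponding to $\lambda_1$. Let $$\tilde b_o=b-\operatorname{sign}(z_1^T\delta)\,\sqrt{\frac{\lambda_1}{\pi}}\;\frac{\Gamma((n-k+1)/2)}{\Gamma((n-k+2)/2)}\,\sqrt{e^Te}\;z_1,$$ $\tilde L_o^2=E((\tilde b_o-\beta)^T(\tilde b_o-\beta))$ and $L^2=E((b-\beta)^T(b-\beta))$. Then $$\frac{\tilde L_o^2}{L^2}=1-\frac{n-k}{\pi}\,\frac{\Gamma^2((n-k+1)/2)}{\Gamma^2((n-k+2)/2)}\,\frac{\lambda_1}{\sum_{i=1}^k\lambda_i}.$$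
   Context: The OLS-estimator is $b=(X^TX)^{-1}X^TY$; its random error is $\delta=b-\beta=(X^TX)^{-1}X^T\varepsilon$; the residual vector is $e=Y-Xb$. The sign function is $\operatorname{sign}(x)=1$ if $x\ge 0$ and $\operatorname{sign}(x)=-1$ if $x<0$. All square roots are nonnegative. $\Gamma$ is the gamma-function, $I_n$ the $n\times n$ identity matrix and $\operatorname{cov}(\varepsilon)$ the variance-covariance matrix. *)

(* Defs.v *)
From HB Require Import structures.
From mathcomp Require Export all_boot all_order all_algebra.
From mathcomp Require Export all_classical all_reals all_analysis.
Set Implicit Arguments.
Unset Strict Implicit.
Unset Printing Implicit Defensive.
Import Order.TTheory GRing.Theory Num.Theory.
Import numFieldNormedType.Exports.
Local Open Scope classical_set_scope.
Local Open Scope ring_scope.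

(* Meaningful for x > 0, where the integral converges. *)
Definition Gamma {R : realType} (x : R) : R :=
  \int[lebesgue_measure]_(t in `]0, +oo[) (t `^ (x - 1) * expR (- t)).

(* Unlike Num.sg, this takes the value 1 at 0. *)
Definition sign {R : realType} (x : R) : R := if 0 <= x then 1 else -1.

Definition dotv {R : realType} {n : nat} (u v : 'cV[R]_n) : R :=
  (u^T *m v) 0 0.

Definition random_vector {d : measure_display} {T : measurableType d}
    {R : realType} {P : probability T R} {n : nat}
    (X : 'I_n -> {RV P >-> R}) (w : T) : 'cV[R]_n :=
  \col_i X i w.

Definition mutually_independent {d : measure_display} {T : measurableType d}
    {R : realType} {P : probability T R} {n : nat}
    (X : 'I_n -> {RV P >-> R}) : Prop :=
  forall (J : {set 'I_n}) (B : 'I_n -> set R),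
    (forall i, measurable (B i)) ->
    P (\bigcap_(i in [set` J]) (X i @^-1` B i)) =
    (\prod_(i in J) P (X i @^-1` B i))%E.

Definition standard_normal_vector {d : measure_display} {T : measurableType d}
    {R : realType} {P : probability T R} {n : nat}
    (Z : 'I_n -> {RV P >-> R}) : Prop :=
  mutually_independent Z /\
  forall (i : 'I_n) (B : set R), measurable B ->
    distribution P (Z i) B = normal_prob 0 1 B.

(* A normal vector is an affine image mu + A Z of a standard normal vector Z.
   The dimension m of Z is free, so degenerate normal vectors are covered on
   any probability space (m is then the rank of the covariance matrix). The
   equality is almost sure, so the property only depends on the law of X. *)
Definition normal_vector {d : measure_display} {T : measurableType d}
    {R : realType} {P : probability T R} {n : nat}
    (X : 'I_n -> {RV P >-> R}) : Prop :=
  exists (m : nat) (mu : 'cV[R]_n) (A : 'M[R]_(n, m))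
         (Z : 'I_m -> {RV P >-> R}),
    standard_normal_vector Z /\
    {ae P, forall w, random_vector X w = mu + A *m random_vector Z w}.

Definition ols {R : realType} {n k : nat} (X : 'M[R]_(n, k)) (Y : 'cV[R]_n) :
    'cV[R]_k :=
  invmx (X^T *m X) *m X^T *m Y.

Definition residual {R : realType} {n k : nat} (X : 'M[R]_(n, k))
    (Y : 'cV[R]_n) : 'cV[R]_n :=
  Y - X *m ols X Y.

(* Not an estimator: through the random error ols X Y - beta it uses the
   unknown beta. *)
Definition btilde_o {R : realType} {n k : nat} (X : 'M[R]_(n, k))
    (beta : 'cV[R]_k) (lambda1 : R) (z1 : 'cV[R]_k) (Y : 'cV[R]_n) :
    'cV[R]_k :=
  let b := ols X Y in
  let delta := b - beta in
  let e := residual X Y in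
  b - (sign (dotv z1 delta) * Num.sqrt (lambda1 / pi) *
       (Gamma ((n%:R - k%:R + 1) / 2) / Gamma ((n%:R - k%:R + 2) / 2)) *
       Num.sqrt (dotv e e)) *: z1.

(* The mean squared error E((b - beta)^T (b - beta)). *)
Definition mse {d : measure_display} {T : measurableType d} {R : realType}
    (P : probability T R) {k : nat} (b : T -> 'cV[R]_k) (beta : 'cV[R]_k) :
    \bar R :=
  'E_P[fun w => dotv (b w - beta) (b w - beta)].

(* Main.v *)
From HB Require Import structures.
Require Import Defs.
From mathcomp Require Import all_boot all_order all_algebra.
From mathcomp Require Import all_classical all_reals all_analysis.
From mathcomp Require Import measurable_realfun.
From mathcomp Require Import ring lra.
Import Order.TTheory GRing.Theory Num.Theory.
Import numFieldNormedType.Exports.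
Local Open Scope classical_set_scope.
Local Open Scope ring_scope.

(** The error of b is B eps with B = (X^T X)^-1 X^T, and the residual is Q eps with
    Q = 1 - X B. Let a = z1^T B eps and r = |Q eps|. Since z1 is a unit vector,
    the squared error of the modified vector is

      |B eps|^2 - 2 kappa |a| r + kappa^2 r^2,

    where kappa = sqrt (lambda1 / pi) Gamma((n-k+1)/2) / Gamma((n-k+2)/2); the
    sign factor is what turns a into |a|. The second moments of |B eps| and r are
    sigma^2 times the traces of (X^T X)^-1 and Q, and z1^T B is orthogonal to Q, so
    a and r are independent: E |a| r = E |a| E r. Here a is centred normal with
    variance sigma^2 lambda1, and r / |sigma| has the chi distribution with n - k
    degrees of freedom. Inserting their means yields E |a| r = kappa E r^2 (lemma
    whitened_abs_norm gives the value), hence the mean squared error drops by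
    kappa^2 sigma^2 (n - k).

    In place of the laws of a and r, the proof uses Laplace transforms of quadratic
    forms. For a standard normal vector Z and a positive definite M, the expectation of
    exp (- Z^T (M - 1) Z / 2) is det(M)^(-1/2): integrals over one coordinate at a
    time (integral_peel) replace M by Schur complements (integral_gauss_quad). For
    the pair (a^2, r^2) the determinant factors, into powers computed with
    det(1 + A B) = det(1 + B A) (integral_gauss_pair, det_1res_mx).

    To pass from Laplace transforms to absolute values, |y| is written as a
    constant times the integral over v of (1 - exp (- v^2 y^2)) / v^2. By Tonelli's
    theorem, expectations of square roots are then determined by Laplace transforms
    (sqrt_from_laplace). This gives the factorization of E |a| r
    (expectation_sqrtM), and comparison with the Gamma density gives the means
    (expectation_sqrt). First moments are obtained by differentiating Laplace
    transforms at 0 (mean_from_laplace); this provides the second moments of linear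
    forms as well as Gamma(x + 1) = x Gamma(x) at half-integers.

    The normal vector eps is almost surely A Z with A of any size; its moments force
    A A^T = sigma^2 (normal_whitening), and this identity is all that the
    computations use about A. *)

Set Implicit Arguments.
Unset Strict Implicit.
Unset Printing Implicit Defensive.

(** * Scaling of Lebesgue measure and Gamma integrals *)

Section ScalingGamma.
Context {R : realType}.
Notation mu := (@lebesgue_measure R).

(** The image of Lebesgue measure under x |-> b x, multiplied by b, gives half-open
    intervals their length. *)
Lemma lebesgue_scale (b : R) (f : R -> \bar R) : 0 < b ->
  measurable_fun setT f -> (forall x, 0 <= f x)%E ->
  (\int[mu]_x f x = b%:E * \int[mu]_x f (b * x)%R)%E.
Proof.
move=> b0 mf f0.
have mb : measurable_fun setT (fun x : R => b * x : measurableTypeR R).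
  exact: measurable_funM.
pose phi := (fun x : R => b * x : measurableTypeR R).
have mphi : measurable_fun setT phi by exact: mb.
pose M0 : {measure set (measurableTypeR R) -> \bar R} :=
  mscale (NngNum (ltW b0)) (pushforward mu phi).
pose M := M0 mphi.
have H : forall A : set (measurableTypeR R), measurable A -> mu A = M A.
  apply: lebesgue_measure_unique => _ [[u v]] _ <-.
  rewrite /M /M0 /= /mscale /= /pushforward.
  have -> : phi @^-1` `]u, v]%classic = `]u / b, v / b]%classic.
    apply/seteqP; split => x /=; rewrite !in_itv /= ltr_pdivrMr// ler_pdivlMr//;
    by rewrite (mulrC x).
  rewrite !lebesgue_measure_itv /= !lte_fin ltr_pM2r ?invr_gt0//.
  case: ifP => _; last by rewrite mule0.
  by rewrite -EFinD -EFinB -EFinM -mulrBl mulrC divfK ?gt_eqF.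
transitivity (\int[M]_x f x)%E.
  by apply: eq_measure_integral => A mA _; exact: H.
rewrite /M /M0 ge0_integral_mscale//= ge0_integral_pushforward//=.
Qed.

(** The integrand of the Gamma integral, extended by 0 so that Tonelli's theorem and
    scaling apply on the whole line. *)
Definition gamma_weight (a x : R) : R :=
  if 0 < x then x `^ (a - 1) * expR (- x) else 0.

(** The Gamma integral with values in the extended reals, usable before its
    convergence is known. *)
Definition egamma (a : R) : \bar R := (\int[mu]_x (gamma_weight a x)%:E)%E.

Lemma gamma_weight_ge0 a x : 0 <= gamma_weight a x.
Proof. by rewrite /gamma_weight; case: ifP => // _; rewrite mulr_ge0 ?powR_ge0 ?expR_ge0. Qed.

Lemma measurable_gamma_weight a : measurable_fun setT (gamma_weight a).
Proof.
apply: measurable_fun_if => //.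
- exact: measurable_fun_ltr.
- rewrite setTI; apply: measurable_funM; last first.
    by apply: measurableT_comp => //; apply: measurable_funTS; exact: oppr_measurable.
  by apply: measurable_funTS; exact: measurable_powR.
Qed.

Lemma egamma_ge0 a : (0 <= egamma a)%E.
Proof. by apply: integral_ge0 => x _; rewrite lee_fin gamma_weight_ge0. Qed.

Lemma Gamma_egamma a : Gamma a = fine (egamma a).
Proof.
rewrite /Gamma /Rintegral /egamma integral_mkcond; congr fine.
apply: eq_integral => x _; rewrite patchE /gamma_weight /=.
by rewrite mem_setE in_itv/= andbT; case: ifP.
Qed.

(** Substitute x |-> (1 + s) x. *)
Lemma egamma_laplace (a s : R) : 0 <= s ->
  (\int[mu]_x (gamma_weight a x * expR (- (s * x)))%:E =
   ((1 + s) `^ (- a))%:E * egamma a)%E.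
Proof.
move=> s0; have b0 : 0 < 1 + s by lra.
have mw := measurable_gamma_weight a.
rewrite /egamma [in RHS](lebesgue_scale b0); last 2 first.
- by apply/measurable_EFinP; exact: mw.
- by move=> x; rewrite lee_fin gamma_weight_ge0.
have mw' : measurable_fun setT (fun x : R => gamma_weight a ((1 + s) * x)).
  by apply: (measurableT_comp mw); exact: measurable_funM.
rewrite muleA -ge0_integralZl//=; last 3 first.
- by apply/measurable_EFinP; exact: mw'.
- by move=> x _; rewrite lee_fin gamma_weight_ge0.
- by rewrite mule_ge0// lee_fin ?powR_ge0// ltW.
apply: eq_integral => x _; rewrite -!EFinM; congr EFin.
rewrite /gamma_weight pmulr_rgt0//; case: ifP => x0; last by rewrite mul0r !mulr0.
rewrite powRM ?ltW// -!mulrA -expRD.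
rewrite [RHS](_ : _ = (1 + s) `^ (- a) * ((1 + s) * (1 + s) `^ (a - 1)) *
   (x `^ (a - 1) * expR (- ((1 + s) * x)))); last by ring.
rewrite -{2}(powRr1 (ltW b0)) -!powRD ?(gt_eqF b0) ?implybT//.
rewrite (_ : - a + _ = 0) ?powRr0 ?mul1r; last by ring.
by congr (_ * expR _); ring.
Qed.

Lemma egamma1 : egamma 1 = 1%E.
Proof.
rewrite /egamma.
transitivity (\int[mu]_(x in `[0%R, +oo[) (expR (- x))%:E)%E.
  rewrite -integral_itv_obnd_cbnd; last first.
    apply/measurable_funTS/measurable_EFinP.
    by apply: measurableT_comp => //; exact: oppr_measurable.
  rewrite [RHS]integral_mkcond; apply: eq_integral => x _.
  rewrite patchE mem_setE in_itv/= andbT /gamma_weight subrr powRr0 mul1r.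
  by case: ifP.
rewrite (@ge0_continuous_FTC2y _ (fun x => expR (- x)) (fun x => - expR (- x)) 0 0).
- by rewrite oppr0 expR0 EFinN oppeK add0e.
- by move=> x _; exact: expR_ge0.
- apply: continuous_subspaceT => x.
  by apply: continuous_comp; [exact: continuousN|exact: continuous_expR].
- rewrite -oppr0; apply: cvgN. exact: cvgr_expR.
- by move=> x _; exact: ex_derive.
- apply: cvg_at_right_filter; apply: cvgN.
  by apply: continuous_comp; [exact: continuousN|exact: continuous_expR].
- move=> x _. rewrite derive1E. rewrite derive_val. rewrite /GRing.scale /=. ring.
Qed.

Lemma integral_gauss_scaled (u : R) : 0 < u ->
  (\int[mu]_y (expR (- (u * y ^+ 2)))%:E = (Num.sqrt pi / Num.sqrt u)%:E)%E.
Proof.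
move=> u0; have su : 0 < Num.sqrt u by rewrite sqrtr_gt0.
have := @integralT_gauss R.
rewrite (lebesgue_scale su); last 2 first.
- by apply/measurable_EFinP; exact: measurable_gauss_fun.
- by move=> x; rewrite lee_fin gauss_fun_ge0.
move=> H; rewrite EFinM -H muleC muleA -EFinM mulVf ?gt_eqF// mul1e.
apply: eq_integral => y _; congr EFin; rewrite /gauss_fun.
by rewrite exprMn sqr_sqrtr ?ltW.
Qed.

Lemma integral_oneDsqrV : (\int[mu]_y ((1 + y ^+ 2)^-1)%:E = pi%:E :> \bar R)%E.
Proof.
have c : continuous (fun y : R => (1 + y ^+ 2)^-1).
  move=> x. apply: cvgV; first by rewrite gt_eqF// ltr_pwDl ?sqr_ge0.
  apply: cvgD; first exact: cvg_cst. exact: sqr_continuous.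
rewrite ge0_symfun_integralT//=; last 2 first.
- by move=> x; rewrite invr_ge0 addr_ge0 ?sqr_ge0.
- by move=> x /=; rewrite sqrrN.
rewrite (_ : [set x | _] = `[0, +oo[%classic); last first.
  by apply/seteqP; split => x/=; rewrite in_itv/= andbT.
rewrite (@ge0_continuous_FTC2y _ _ atan 0 (pi / 2)).
- by rewrite atan0 sube0 -EFinM mulrC divfK.
- by move=> x _; rewrite invr_ge0 addr_ge0 ?sqr_ge0.
- exact: continuous_subspaceT.
- exact: cvgy_atan.
- by move=> x _; exact: derivable_atan.
- by apply: cvg_at_right_filter; exact: continuous_atan.
- by move=> x _; exact: derive1_atan.
Qed.

End ScalingGamma.

(** * The absolute value as a mixture of Gaussian functions *)

Section AbsKernel.
Context {R : realType}.
Notation mu := (@lebesgue_measure R).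

(** For x > 0, sqrt pi / sqrt x is the integral over y of exp (- x y^2). Exchanging
    the two integrals in sqrt pi times the Gamma integral at 1/2 leaves the integral
    of 1 / (1 + y^2), which is pi. *)
Lemma egamma_half : egamma (2^-1) = (Num.sqrt pi)%:E :> \bar R.
Proof.
have sp : 0 < Num.sqrt pi :> R by rewrite sqrtr_gt0 pi_gt0.
have mw := measurable_gamma_weight (1 : R).
have mw2 := measurable_gamma_weight (2^-1 : R).
pose h (z : R * R) : \bar R := (gamma_weight 1 z.1 * expR (- (z.1 * z.2 ^+ 2)))%:E.
have mh : measurable_fun setT h.
  apply/measurable_EFinP; apply: measurable_funM.
    exact: (measurableT_comp mw).
  apply: measurableT_comp => //; apply: measurableT_comp => //.
  apply: measurable_funM => //; exact: measurable_funX.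
have h0 z : (0 <= h z)%E by rewrite lee_fin mulr_ge0 ?expR_ge0 ?gamma_weight_ge0.
have /= := @fubini_tonelli _ _ _ _ R mu mu h mh h0.
have -> : (\int[mu]_x \int[mu]_y h (x, y) = (Num.sqrt pi)%:E * egamma (2^-1))%E.
  rewrite -ge0_integralZl//=; last 2 first.
  - by apply/measurable_EFinP; exact: mw2.
  - by move=> x _; rewrite lee_fin gamma_weight_ge0.
  apply: eq_integral => x _; rewrite /h/=.
  under eq_integral do rewrite EFinM.
  rewrite ge0_integralZl//=; last 2 first.
  - apply/measurable_EFinP; apply: measurableT_comp => //; apply: measurableT_comp => //.
    by apply: measurable_funM => //; exact: measurable_funX.
  - by rewrite lee_fin gamma_weight_ge0.
  rewrite /gamma_weight; case: ifPn => x0; last by rewrite mul0e mule0.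
  rewrite integral_gauss_scaled// -EFinM; congr EFin.
  rewrite subrr powRr0 mul1r (_ : 2^-1 - 1 = - 2^-1); last by field.
  by rewrite powRN powR12_sqrt ?ltW//; ring.
have -> : (\int[mu]_y \int[mu]_x h (x, y) = pi%:E)%E.
  rewrite -integral_oneDsqrV; apply: eq_integral => y _.
  rewrite /h/=.
  under eq_integral do rewrite mulrC [_ * (y ^+ 2)]mulrC mulrC.
  rewrite egamma_laplace ?sqr_ge0// egamma1 mule1 powR_inv1//.
  by rewrite addr_ge0 ?sqr_ge0.
move=> H; have : ((Num.sqrt pi)^-1%:E * ((Num.sqrt pi)%:E * egamma 2^-1) =
    (Num.sqrt pi)^-1%:E * pi%:E :> \bar R)%E by rewrite H.
rewrite muleA -EFinM mulVf ?gt_eqF// mul1e => ->.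
by rewrite -EFinM -{2}(sqr_sqrtr (pi_ge0 R)) expr2 mulKf// gt_eqF.
Qed.

(** Integrating over v recovers |y| up to a constant, while for fixed v the kernel
    only involves exp (- v^2 y^2). This is what turns expectations of absolute
    values into Laplace transforms of squares. *)
Definition abs_kernel (v y : R) : R := (1 - expR (- (v * y) ^+ 2)) / v ^+ 2.

Definition abs_const : \bar R := (\int[mu]_v (abs_kernel v 1)%:E)%E.

Lemma abs_kernel_ge0 v y : 0 <= abs_kernel v y.
Proof.
rewrite /abs_kernel divr_ge0 ?sqr_ge0// subr_ge0 -expR0 ler_expR.
by rewrite oppr_le0 sqr_ge0.
Qed.

Lemma measurable_abs_kernel d (T : measurableType d) (f g : T -> R) :
  measurable_fun setT f -> measurable_fun setT g ->
  measurable_fun setT (fun t => abs_kernel (f t) (g t)).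
Proof.
move=> mf mg; apply: measurable_funM.
  apply: measurable_funB => //; apply: measurableT_comp => //.
  apply: measurableT_comp => //; apply: measurable_funX.
  exact: measurable_funM.
rewrite (_ : (fun t => _) = fun t => (f t ^+ 2) `^ (-1)).
  apply: (measurableT_comp (measurable_powR _)) => //.
  exact: measurable_funX.
by apply/funext => t; rewrite powR_inv1 ?sqr_ge0.
Qed.

(** The kernel is homogeneous: replacing v by |y| v takes out the factor |y|. *)
Lemma integral_abs_kernel y :
  (\int[mu]_v (abs_kernel v y)%:E = `|y|%:E * abs_const)%E.
Proof.
have [->|y0] := eqVneq y 0.
  rewrite normr0 mul0e; apply: integral0_eq => v _.
  by rewrite /abs_kernel mulr0 expr0n oppr0 expR0 subrr mul0r.
have ay : 0 < `|y| by rewrite normr_gt0.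
rewrite /abs_const [in RHS](lebesgue_scale ay); last 2 first.
- by apply/measurable_EFinP; apply: measurable_abs_kernel.
- by move=> v; rewrite lee_fin abs_kernel_ge0.
rewrite muleA -EFinM -ge0_integralZl//=; last 2 first.
- by apply/measurable_EFinP; apply: measurable_abs_kernel => //; exact: measurable_funM.
- by move=> v _; rewrite lee_fin abs_kernel_ge0.
apply: eq_integral => v _; rewrite -EFinM; congr EFin.
rewrite -expr2 /abs_kernel mulr1 !exprMn real_normK ?num_real//.
rewrite [v ^+ 2 * _]mulrC; set e := expR _.
by rewrite [(y ^+ 2 * _)^-1]invfM mulrCA (mulrA (y ^+ 2)) mulfV ?mul1r ?sqrf_eq0.
Qed.

(** Subtraction of integrals, by adding the nonnegative integrand w u to both sides. *)
Lemma integral_one_sub d (T : measurableType d) (nu : {measure set T -> \bar R})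
  (w u : T -> R) (K L : R) :
  (forall t, 0 <= w t) -> (forall t, 0 <= u t <= 1) ->
  measurable_fun setT w -> measurable_fun setT u ->
  (\int[nu]_t (w t)%:E = K%:E)%E -> (\int[nu]_t (w t * u t)%:E = L%:E)%E ->
  (\int[nu]_t (w t * (1 - u t))%:E = (K - L)%:E)%E.
Proof.
move=> w0 u01 mw mu_ HK HL.
have : (\int[nu]_t (w t * (1 - u t))%:E + \int[nu]_t (w t * u t)%:E =
        \int[nu]_t (w t)%:E)%E.
  rewrite -ge0_integralD//=; last 4 first.
  - by move=> t _; rewrite lee_fin mulr_ge0// subr_ge0; case/andP: (u01 t).
  - by apply/measurable_EFinP; apply: measurable_funM => //; exact: measurable_funB.
  - by move=> t _; rewrite lee_fin mulr_ge0//; case/andP: (u01 t).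
  - by apply/measurable_EFinP; exact: measurable_funM.
  by apply: eq_integral => t _; rewrite -EFinD; congr EFin; ring.
by rewrite HK HL => H; rewrite EFinB -H addeK.
Qed.

(** Tonelli's theorem for the kernel representation of |y|. *)
Lemma weighted_abs d (T : measurableType d) (nu : {sigma_finite_measure set T -> \bar R})
  (w y : T -> R) : (forall t, 0 <= w t) -> measurable_fun setT w -> measurable_fun setT y ->
  (abs_const * \int[nu]_t (w t * `|y t|)%:E =
   \int[mu]_v ((v ^+ 2)^-1%:E * \int[nu]_t (w t * (1 - expR (- (v * y t) ^+ 2)))%:E))%E.
Proof.
move=> w0 mw my.
have c0 : (0 <= abs_const)%E by apply: integral_ge0 => v _; rewrite lee_fin abs_kernel_ge0.
pose h (z : T * R) : \bar R := (w z.1 * abs_kernel z.2 (y z.1))%:E.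
have mh : measurable_fun setT h.
  apply/measurable_EFinP; apply: measurable_funM.
    exact: (measurableT_comp mw).
  apply: measurable_abs_kernel => //.
  exact: (measurableT_comp my).
have h0 z : (0 <= h z)%E by rewrite lee_fin mulr_ge0 ?abs_kernel_ge0.
have /= := @fubini_tonelli _ _ _ _ R nu mu h mh h0.
have -> : (\int[nu]_x \int[mu]_v h (x, v) = abs_const * \int[nu]_t (w t * `|y t|)%:E)%E.
  rewrite -ge0_integralZl//=; last 2 first.
  - apply/measurable_EFinP; apply: measurable_funM => //.
    exact: measurableT_comp.
  - by move=> x _; rewrite lee_fin mulr_ge0.
  apply: eq_integral => x _; rewrite /h/=.
  under eq_integral do rewrite EFinM.
  rewrite ge0_integralZl//=; last 3 first.
  - by apply/measurable_EFinP; apply: measurable_abs_kernel.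
  - by move=> v _; rewrite lee_fin abs_kernel_ge0.
  - by rewrite lee_fin.
  by rewrite integral_abs_kernel EFinM muleA muleC.
move=> ->; apply: eq_integral => v _.
rewrite -ge0_integralZl//=; last 3 first.
- apply/measurable_EFinP; apply: measurable_funM => //.
  apply: measurable_funB => //; apply: measurableT_comp => //.
  apply: measurableT_comp => //; apply: measurable_funX.
  exact: measurable_funM.
- move=> x _; rewrite lee_fin mulr_ge0// subr_ge0 -expR0 ler_expR.
  by rewrite oppr_le0 sqr_ge0.
- by rewrite lee_fin invr_ge0 sqr_ge0.
by apply: eq_integral => x _; rewrite /h /abs_kernel/= -EFinM; congr EFin; ring.
Qed.

(** The kernel formula for sqrt x under the density exp (- x): the Laplace transform
    there is 1 / (1 + v^2), so the right-hand side becomes the integral of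
    1 / (1 + v^2). *)
Lemma abs_const_egamma : (abs_const * egamma (2^-1 + 1) = pi%:E)%E.
Proof.
have mw := measurable_gamma_weight (1 : R).
have ms : measurable_fun setT (fun x : R => Num.sqrt x : R).
  by apply: continuous_measurable_fun; exact: sqrt_continuous.
have := @weighted_abs _ _ mu (gamma_weight 1) (fun x : R => Num.sqrt x) (gamma_weight_ge0 _) mw ms.
rewrite (_ : (\int[mu]_t (gamma_weight 1 t * `|Num.sqrt t|)%:E)%E = egamma (2^-1 + 1)); last first.
  apply: eq_integral => x _; congr EFin; rewrite /gamma_weight.
  case: ifPn => x0; last by rewrite mul0r.
  rewrite subrr powRr0 mul1r ger0_norm ?sqrtr_ge0// addrK powR12_sqrt ?ltW//.
  by rewrite mulrC.
move=> ->; rewrite -integral_oneDsqrV.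
have mD : measurable ([set: R] `\ 0) by exact: measurableD.
have mI : measurable_fun setT (fun v : R => ((1 + v ^+ 2)^-1)%:E).
  apply/measurable_EFinP; rewrite (_ : (fun v => _) = fun v : R => (1 + v ^+ 2) `^ (-1)).
    apply: (measurableT_comp (measurable_powR _)) => //.
    by apply: measurable_funD => //; exact: measurable_funX.
  by apply/funext => t; rewrite powR_inv1 ?addr_ge0 ?sqr_ge0.
have E v : v != 0 ->
    ((v ^+ 2)^-1%:E * \int[mu]_t (gamma_weight 1 t *
       (1 - expR (- (v * Num.sqrt t) ^+ 2)))%:E = ((1 + v ^+ 2)^-1)%:E)%E.
  move=> v0; rewrite (@integral_one_sub _ _ mu (gamma_weight 1) _ 1 ((1 + v ^+ 2)^-1)).
  - rewrite -EFinM; congr EFin; field.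
    by rewrite v0 gt_eqF// ltr_pwDl ?sqr_ge0.
  - exact: gamma_weight_ge0.
  - by move=> t; rewrite expR_ge0 -expR0 ler_expR oppr_le0 sqr_ge0.
  - by [].
  - apply: measurableT_comp => //; apply: measurableT_comp => //.
    by apply: measurable_funX; exact: measurable_funM.
  - exact: egamma1.
  - transitivity (\int[mu]_x (gamma_weight 1 x * expR (- (v ^+ 2 * x)))%:E)%E.
      apply: eq_integral => x _; congr EFin; rewrite /gamma_weight.
      case: ifPn => x0; last by rewrite !mul0r.
      by rewrite exprMn sqr_sqrtr// ltW.
    by rewrite egamma_laplace ?sqr_ge0// egamma1 mule1 powR_inv1// addr_ge0 ?sqr_ge0.
rewrite -[LHS](@integral_setD1 R _ 0) //=; last first.
  apply: (eq_measurable_fun (fun v : R => ((1 + v ^+ 2)^-1)%:E)).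
    by move=> v; rewrite inE /= => -[_ /eqP v0]; rewrite E.
  exact: measurable_funTS.
rewrite -[RHS](@integral_setD1 R _ 0) //=; last exact: measurable_funTS.
by apply: eq_integral => v; rewrite inE /= => -[_ /eqP v0]; exact: E.
Qed.

(** The product of the constant with a Gamma integral is the finite positive number
    pi, which excludes both 0 and infinity. *)
Lemma abs_const_pos : exists2 c : R, 0 < c & abs_const = c%:E.
Proof.
have c0 : (0 <= abs_const)%E by apply: integral_ge0 => v _; rewrite lee_fin abs_kernel_ge0.
have := abs_const_egamma; have := egamma_ge0 (2^-1 + 1 : R).
move: c0; case: abs_const => [c| |]//; last first.
  move=> _; case: (egamma _) => [g| |]//.
  move=> _; have [->|g0] := eqVneq g 0.
      by rewrite mule0 => -[pi0]; have := pi_gt0 R; rewrite -pi0 ltxx.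
    by rewrite mulyr /Num.sg (negPf g0); case: ifP => _; rewrite ?mul1e ?mulN1e.
rewrite lee_fin => c0 _ H; exists c => //.
rewrite lt_neqAle c0 andbT; apply/eqP => c00.
by move: H; rewrite -c00 mul0e => -[pi0]; have := pi_gt0 R; rewrite -pi0 ltxx.
Qed.

End AbsKernel.

(** * Square roots are determined by Laplace transforms *)

Section SqrtLaplace.
Context {R : realType}.
Notation mu := (@lebesgue_measure R).

Lemma measurable_fun_sqrt d (T : measurableType d) (f : T -> R) :
  measurable_fun setT f -> measurable_fun setT (fun t => Num.sqrt (f t)).
Proof.
move=> mf; have ms : measurable_fun setT (fun x : R => Num.sqrt x : R).
  by apply: continuous_measurable_fun; exact: sqrt_continuous.
exact: (measurableT_comp ms mf).
Qed.

Lemma measurable_fun_expN d (T : measurableType d) (f : T -> R) :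
  measurable_fun setT f -> measurable_fun setT (fun t => expR (- f t)).
Proof. by move=> mf; do 2 apply: measurableT_comp => //. Qed.

(** Up to the constant of the kernel formula, both sides are the same integral over
    s = v^2 of the quantities assumed to be equal. The two measures may live on
    different spaces, so that expectations can be compared with Gamma integrals. *)
Lemma sqrt_from_laplace d (T : measurableType d)
    (nu : {sigma_finite_measure set T -> \bar R}) (w q : T -> R) d' (T' : measurableType d')
    (nu' : {sigma_finite_measure set T' -> \bar R}) (v q' : T' -> R) :
  (forall t, 0 <= w t) -> measurable_fun setT w ->
  (forall t, 0 <= q t) -> measurable_fun setT q ->
  (forall t, 0 <= v t) -> measurable_fun setT v ->
  (forall t, 0 <= q' t) -> measurable_fun setT q' ->
  (forall s : R, (0 <= s)%R ->
    \int[nu]_t (w t * (1 - expR (- (s * q t))))%:E =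
    \int[nu']_t (v t * (1 - expR (- (s * q' t))))%:E)%E ->
  (\int[nu]_t (w t * Num.sqrt (q t))%:E = \int[nu']_t (v t * Num.sqrt (q' t))%:E)%E.
Proof.
move=> w0 mw q0 mq v0 mv q'0 mq' H.
have [C C0 CE] := @abs_const_pos R.
have := weighted_abs nu w0 mw (measurable_fun_sqrt mq).
have := weighted_abs nu' v0 mv (measurable_fun_sqrt mq').
rewrite !CE.
under eq_integral do rewrite ger0_norm ?sqrtr_ge0//.
move=> E1; under eq_integral do rewrite ger0_norm ?sqrtr_ge0//.
move=> E2.
have E3 : (C%:E * \int[nu]_t (w t * Num.sqrt (q t))%:E =
    C%:E * \int[nu']_t (v t * Num.sqrt (q' t))%:E)%E.
  rewrite E1 E2; apply: eq_integral => x _; congr (_ * _)%E.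
  have := H (x ^+ 2) (sqr_ge0 x).
  under eq_integral do rewrite -[q _]sqr_sqrtr// -exprMn.
  under [in RHS]eq_integral do rewrite -[q' _]sqr_sqrtr// -exprMn.
  by [].
have := congr1 (fun z => (C^-1)%:E * z)%E E3.
by rewrite !muleA -!EFinM mulVf ?gt_eqF// !mul1e.
Qed.
End SqrtLaplace.

(** * First moments from Laplace transforms and the Gamma recursion *)

Section MeanLaplace.
Context {R : realType}.
Notation mu := (@lebesgue_measure R).

(** Derivatives as limits along a fixed sequence, the form needed for monotone
    convergence. *)
Lemma cvg_dyadic_slope (f : R -> R) (l : R) : is_derive (0 : R) 1 f l ->
  (f (2^-1 ^+ n) - f 0) / 2^-1 ^+ n @[n --> \oo] --> l.
Proof.
move=> df.
have [df1 df2] := df.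
have h0 : (2^-1 : R) ^+ n @[n --> \oo] --> (0 : R).
  by apply: cvg_expr; rewrite ger0_norm ?invr_ge0// invf_lt1// ltr1n.
have : (fun h : R => h^-1 *: (f (h *: (1:R) + 0) - f 0)) @ 0^' --> l.
  by rewrite -df2; exact: df1.
move/cvgr_dnbhsP => /(_ (fun n => 2^-1 ^+ n)).
have hn0 : forall n, (2^-1 : R) ^+ n != 0 by move=> n; rewrite expf_neq0// invr_eq0.
move=> /(_ (conj hn0 h0)).
apply: cvg_trans; apply: near_eq_cvg; apply: nearW => n /=.
by rewrite /GRing.scale/= mulr1 addr0 mulrC.
Qed.

Lemma cvg_one_sub_expRN (q : R) :
  (1 - expR (- (2^-1 ^+ n * q))) / 2^-1 ^+ n @[n --> \oo] --> q.
Proof.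
have D : is_derive (0 : R) 1 (fun x => - expR (- (x * q))) q.
  apply: is_derive_eq.
  by rewrite /GRing.scale/= mul0r oppr0 expR0; ring.
have := cvg_dyadic_slope D.
by under eq_fun do rewrite mul0r oppr0 expR0 opprK addrC.
Qed.

Lemma one_sub_expRN_ge0 (x : R) : 0 <= x -> 0 <= 1 - expR (- x).
Proof. by move=> x0; rewrite subr_ge0 -expR0 ler_expR oppr_le0. Qed.

(** Halving the step h replaces (1 - e^2) / (2 h) by (1 - e) / h, where
    e = exp (- h q), and 1 - e^2 <= 2 (1 - e). *)
Lemma one_sub_expRN_mono (q : R) (m n : nat) : (m <= n)%N ->
  (1 - expR (- (2^-1 ^+ m * q))) / 2^-1 ^+ m <=
  (1 - expR (- (2^-1 ^+ n * q))) / 2^-1 ^+ n.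
Proof.
move: m n; apply: (@homo_leq R
  (fun n => (1 - expR (- (2^-1 ^+ n * q))) / 2^-1 ^+ n) (fun x y => x <= y)) => [x//|y x z|n].
  exact: le_trans.
set h := (2^-1 : R) ^+ n.+1.
have h0 : 0 < h by rewrite exprn_gt0// invr_gt0.
have -> : 2^-1 ^+ n = 2 * h by rewrite /h exprS mulrA divff ?mul1r.
have -> : expR (- (2 * h * q)) = expR (- (h * q)) ^+ 2.
  by rewrite expr2 -expRD; congr expR; ring.
set e := expR _.
rewrite ler_pdivrMr; last by rewrite mulr_gt0.
rewrite (mulrC 2) mulrA divfK ?gt_eqF//.
rewrite -subr_ge0 (_ : _ - _ = (1 - e) ^+ 2) ?sqr_ge0//; ring.
Qed.

(** The quotients (1 - exp (- h q)) / h increase to q as h runs through the powers of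
    1/2, so
    monotone convergence gives the first moment as a derivative at 0. *)
Lemma mean_from_laplace d (T : measurableType d)
    (nu : {measure set T -> \bar R}) (w q : T -> R) (L : R -> R) (l : R) :
  (forall t, 0 <= w t) -> measurable_fun setT w ->
  (forall t, 0 <= q t) -> measurable_fun setT q ->
  (forall s : R, (0 <= s)%R ->
    \int[nu]_t (w t * (1 - expR (- (s * q t))))%:E = (L s)%:E)%E ->
  L 0 = 0 -> is_derive (0 : R) 1 L l ->
  (\int[nu]_t (w t * q t)%:E = l%:E)%E.
Proof.
move=> w0 mw q0 mq HL L0 dL.
pose g n t : \bar R := (w t * ((1 - expR (- (2^-1 ^+ n * q t))) / 2^-1 ^+ n))%:E.
have h0 n : 0 < (2^-1 : R) ^+ n by rewrite exprn_gt0// invr_gt0.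
have g0 n t : setT t -> (0 <= g n t)%E.
  move=> _; rewrite lee_fin; apply: mulr_ge0 => //; apply: divr_ge0; last exact: ltW.
  by apply: one_sub_expRN_ge0; rewrite mulr_ge0// ltW.
have mg n : measurable_fun setT (g n).
  apply/measurable_EFinP; apply: measurable_funM => //; apply: measurable_funM => //.
  by apply: measurable_funB => //; apply: measurable_fun_expN; exact: measurable_funM.
have ndg t : setT t -> {homo g ^~ t : m n / (m <= n)%N >-> (m <= n)%E}.
  by move=> _ m n mn; rewrite lee_fin ler_wpM2l// one_sub_expRN_mono.
have := @cvg_monotone_convergence _ _ _ nu _ measurableT _ mg g0 ndg.
have -> : (\int[nu]_t limn (g ^~ t) = \int[nu]_t (w t * q t)%:E)%E.
  apply: eq_integral => t _; apply/cvg_lim => //; apply: cvg_EFin; first exact: nearW.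
  by apply: cvgM; [exact: cvg_cst|exact: cvg_one_sub_expRN].
move/cvg_lim => <- //; apply/cvg_lim => //.
have := cvg_dyadic_slope dL.
rewrite L0; under eq_fun do rewrite subr0.
move=> H.
rewrite (_ : (fun n => _) = (fun n => ((L (2^-1 ^+ n)) / 2^-1 ^+ n)%:E)).
  by apply: cvg_EFin; first exact: nearW.
apply/funext => n; rewrite EFinM -HL ?ltW// muleC -ge0_integralZl//=; last 2 first.
- apply/measurable_EFinP; apply: measurable_funM => //.
  by apply: measurable_funB => //; apply: measurable_fun_expN; exact: measurable_funM.
- move=> t _; rewrite lee_fin; apply: mulr_ge0 => //.
  by apply: one_sub_expRN_ge0; rewrite mulr_ge0// ltW.
by apply: eq_integral => t _; rewrite /g -EFinM; congr EFin; ring.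
Qed.

Lemma is_derive_laplace (c a : R) :
  is_derive (0 : R) 1 (fun s => 1 - (1 + c * s) `^ (- a)) (c * a).
Proof.
have D : is_derive (0 : R) 1 (fun s => 1 - expR (- a * ln (1 + c * s))) (c * a).
  have Dl : is_derive (1 + c * 0 : R) 1 (@ln R) (1 + c * 0)^-1.
    by apply: is_derive1_ln; rewrite mulr0 addr0.
  apply: is_derive_eq.
  rewrite /GRing.scale/= mulr0 addr0 ln1 mulr0 expR0 invr1; ring.
apply: near_eq_is_derive D => //.
have P : \forall s \near (0 : R), 0 < 1 + c * s.
  have := @cvgr_gt _ _ (nbhs (0 : R)) _ (fun s : R => 1 + c * s) (1 + c * 0). apply; last by rewrite mulr0 addr0.
  by apply: cvgD; [exact: cvg_cst|apply: cvgM; [exact: cvg_cst|exact: cvg_id]].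
by apply: filterS P => s s0; rewrite /powR gt_eqF// mulNr.
Qed.

(** The derivative at 0 of the Laplace transform (1 + s)^(-a) computes the first
    moment of the Gamma weight. *)
Lemma egammaD1 (a g : R) : 0 < a -> egamma a = g%:E -> egamma (a + 1) = (a * g)%:E.
Proof.
move=> a0 Hg; have mw := measurable_gamma_weight a.
have D : is_derive (0 : R) 1 (fun s => g * (1 - (1 + 1 * s) `^ (- a))) (a * g).
  have D1 := is_derive_laplace 1 a.
  by apply: is_derive_eq; rewrite /GRing.scale/=; ring.
rewrite -(@mean_from_laplace _ _ mu (gamma_weight a) (fun x => `|x|) _ _ _ mw _ _ _ _ D).
- apply: eq_integral => x _; congr EFin; rewrite /gamma_weight.
  case: ifPn => x0; last by rewrite mul0r.
  by rewrite gtr0_norm// addrK [RHS]mulrC mulrA mulr_powRB1// ltW.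
- exact: gamma_weight_ge0.
- by [].
- exact: normr_measurable.
- move=> s s0; rewrite (@integral_one_sub _ _ _ mu _ _ g (g * (1 + s) `^ (- a))).
  + by congr EFin; rewrite mul1r; ring.
  + exact: gamma_weight_ge0.
  + by move=> t; rewrite expR_ge0 -expR0 ler_expR oppr_le0 mulr_ge0.
  + exact: mw.
  + by apply: measurable_fun_expN; apply: measurable_funM => //; exact: normr_measurable.
  + exact: Hg.
  + rewrite [RHS](_ : _ = ((1 + s) `^ (- a))%:E * egamma a)%E; last by rewrite Hg -EFinM mulrC.
    have <- := egamma_laplace a s0; apply: eq_integral => x _; congr EFin.
    by rewrite /gamma_weight; case: ifPn => x0; rewrite ?mul0r// gtr0_norm.
- by rewrite mulr0 addr0 powR1 subrr mulr0.
Qed.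

(** Induction in steps of two from the values at 1/2 and 1. *)
Lemma egamma_half_int (j : nat) :
  exists2 g : R, 0 < g & egamma (j.+1%:R / 2) = g%:E.
Proof.
elim/ltn_ind: j => -[|[|j]] IH.
- by exists (Num.sqrt pi); rewrite ?sqrtr_gt0 ?pi_gt0// mul1r egamma_half.
- by exists 1 => //; rewrite divff// egamma1.
have [|g g0 E] := IH j; first by rewrite ltnS leqnSn.
exists (j.+1%:R / 2 * g); first by rewrite !mulr_gt0.
have <- := egammaD1 (divr_gt0 (ltr0Sn _ _) (ltr0Sn _ _)) E; congr egamma.
have -> : j.+3%:R = j.+1%:R + 2%:R :> R by rewrite -natrD addn2.
by field.
Qed.


End MeanLaplace.

(** * Square roots of Gamma-distributed variables *)

Section GammaLaws.
Context {R : realType}.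
Notation mu := (@lebesgue_measure R).

Lemma expRN_itv (x : R) : 0 <= x -> 0 <= expR (- x) <= 1.
Proof. by move=> x0; rewrite expR_ge0 -expR0 ler_expR oppr_le0. Qed.

Lemma Gamma_half_int (j : nat) : 0 < Gamma (j.+1%:R / 2 : R) /\
  egamma (j.+1%:R / 2 : R) = (Gamma (j.+1%:R / 2))%:E.
Proof. by have [g g0 E] := @egamma_half_int R j; rewrite Gamma_egamma E. Qed.

Lemma Gamma_half_intD1 (j : nat) :
  Gamma (j.+1%:R / 2 + 1 : R) = j.+1%:R / 2 * Gamma (j.+1%:R / 2).
Proof.
have [g0 E] := Gamma_half_int j.
by rewrite Gamma_egamma (egammaD1 _ E) ?divr_gt0.
Qed.

Section Prob.
Context d (T : measurableType d) (P : probability T R).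

Lemma integral_scaled_one_sub (k : R) (q : T -> R) (l : R) :
  0 <= k -> (forall t, 0 <= q t) -> measurable_fun setT q ->
  (\int[P]_t (expR (- q t))%:E = l%:E)%E ->
  (\int[P]_t (k * (1 - expR (- q t)))%:E = (k * (1 - l))%:E)%E.
Proof.
move=> k0 q0 mq H.
rewrite (_ : k * (1 - l) = k - k * l); last by ring.
apply: (@integral_one_sub _ _ _ P (cst k)) => //.
- by move=> t; exact: expRN_itv.
- exact: measurable_fun_expN.
- transitivity (\int[P]_t (cst k%:E t))%E; first by [].
  by rewrite integral_cst//= probability_setT mule1.
- transitivity (\int[P]_t (k%:E * (expR (- q t))%:E))%E; first by [].
  rewrite ge0_integralZl//=; last first.
    by apply/measurable_EFinP; exact: measurable_fun_expN.
  by rewrite H EFinM.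
Qed.

(** A variable with Laplace transform (1 + c s)^(-a) is compared with c x under the
    Gamma weight of parameter a: the square root raises the parameter by 1/2. *)
Lemma expectation_sqrt (q : T -> R) (c : R) (j : nat) :
  (forall t, 0 <= q t) -> measurable_fun setT q -> 0 < c ->
  (forall s : R, (0 <= s)%R ->
    \int[P]_t (expR (- (s * q t)))%:E = ((1 + c * s) `^ (- (j.+1%:R / 2)))%:E)%E ->
  (\int[P]_t (Num.sqrt (q t))%:E =
   (Num.sqrt c * Gamma (j.+2%:R / 2) / Gamma (j.+1%:R / 2))%:E)%E.
Proof.
move=> q0 mq c0 H.
have [g0 gE] := Gamma_half_int j; have [h0 hE] := Gamma_half_int j.+1.
set a := j.+1%:R / 2 in H g0 gE *; set g := Gamma a in g0 gE *.
have a2 : j.+2%:R / 2 = a + 2^-1 :> R by rewrite /a -natr1; field.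
have mw := measurable_gamma_weight a.
have mabs : measurable_fun setT (fun x : R => c * `|x|).
  by apply: measurable_funM => //; exact: normr_measurable.
have := @sqrt_from_laplace R _ T P (cst g) q _ _ mu (gamma_weight a) (fun x => c * `|x|).
move=> /(_ (fun=> ltW g0) (measurable_cst _) q0 mq (gamma_weight_ge0 _) mw).
move=> /(_ (fun x => mulr_ge0 (ltW c0) (normr_ge0 _)) mabs) /=.
have -> : (\int[mu]_t (gamma_weight a t * Num.sqrt (c * `|t|))%:E =
   (Num.sqrt c)%:E * egamma (j.+2%:R / 2))%E.
  rewrite /egamma -ge0_integralZl//=; last 2 first.
  - by apply/measurable_EFinP; exact: measurable_gamma_weight.
  - by move=> x _; rewrite lee_fin gamma_weight_ge0.
  apply: eq_integral => x _; rewrite -EFinM; congr EFin.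
  rewrite /gamma_weight; case: ifPn => x0; last by rewrite mul0r mulr0.
  rewrite gtr0_norm// sqrtrM ?ltW// -(powR12_sqrt (ltW x0)) a2.
  rewrite (_ : a + 2^-1 - 1 = a - 1 + 2^-1); last by ring.
  by rewrite [x `^ (_ + 2^-1)]powRD ?(gt_eqF x0) ?implybT//; ring.
rewrite hE => E.
have /E : forall s : R, (0 <= s)%R ->
    (\int[P]_t (g * (1 - expR (- (s * q t))))%:E =
    \int[mu]_t (gamma_weight a t * (1 - expR (- (s * (c * `|t|)))))%:E)%E.
  move=> s s0; have cs : 0 <= c * s by rewrite mulr_ge0// ltW.
  rewrite (@integral_scaled_one_sub _ _ ((1 + c * s) `^ (- a)))//; last 4 first.
  - exact: ltW.
  - by move=> t; rewrite mulr_ge0.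
  - exact: measurable_funM.
  - by rewrite H.
  rewrite (@integral_one_sub _ _ _ mu _ _ g (g * (1 + c * s) `^ (- a))).
  - by congr EFin; ring.
  - exact: gamma_weight_ge0.
  - by move=> t; rewrite expRN_itv// mulr_ge0// mulr_ge0// ltW.
  - exact: mw.
  - by apply: measurable_fun_expN; apply: measurable_funM.
  - exact: gE.
  - rewrite mulrC EFinM -gE -egamma_laplace//; apply: eq_integral => x _; congr EFin.
    rewrite /gamma_weight; case: ifPn => x0; rewrite ?mul0r// gtr0_norm//.
    by congr (_ * expR _); ring.
under eq_integral do rewrite EFinM.
rewrite ge0_integralZl//=; last 2 first.
- by apply/measurable_EFinP; exact: measurable_fun_sqrt.
- by rewrite lee_fin ltW.
move=> /(congr1 (fun z => (g^-1)%:E * z)%E).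
rewrite !muleA -!EFinM mulVf ?gt_eqF// mul1e => ->.
by congr EFin; ring.
Qed.

(** Independence enters as a factorization of the joint Laplace transform. The
    comparison lemma
    is used twice: with weight 1 - exp (- s q) to extract sqrt p, then with weight
    sqrt p to extract sqrt q. *)
Lemma expectation_sqrtM (p q : T -> R) (phi psi : R -> R) (m : R) :
  (forall t, 0 <= p t) -> measurable_fun setT p ->
  (forall t, 0 <= q t) -> measurable_fun setT q ->
  (forall s t : R, (0 <= s)%R -> (0 <= t)%R ->
    \int[P]_x (expR (- (s * p x + t * q x)%R))%:E = (phi s * psi t)%:E)%E ->
  phi 0 = 1 -> psi 0 = 1 -> 0 <= m ->
  (\int[P]_x (Num.sqrt (p x))%:E = m%:E)%E ->
  (\int[P]_x (Num.sqrt (p x) * Num.sqrt (q x))%:E =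
   m%:E * \int[P]_x (Num.sqrt (q x))%:E)%E.
Proof.
move=> p0 mp q0 mq H phi0 psi0 m0 Hm.
have Hq (t : R) : 0 <= t -> (\int[P]_x (expR (- (t * q x)))%:E = (psi t)%:E)%E.
  move=> t0; have := H 0 t (lexx _) t0; rewrite phi0 mul1r => <-.
  by apply: eq_integral => x _; rewrite mul0r add0r.
have Hp (t : R) : 0 <= t -> (\int[P]_x (expR (- (t * p x)))%:E = (phi t)%:E)%E.
  move=> t0; have := H t 0 t0 (lexx _); rewrite psi0 mulr1 => <-.
  by apply: eq_integral => x _; rewrite mul0r addr0.
have mexp (f : T -> R) : measurable_fun setT f -> measurable_fun setT (fun x => 1 - expR (- f x) : R).
  by move=> mf; apply: measurable_funB => //; exact: measurable_fun_expN.
have psi1 (s : R) : 0 <= s -> 0 <= 1 - psi s.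
  move=> s0; have := @integral_scaled_one_sub 1 (fun x => s * q x) (psi s) ler01.
  rewrite mul1r -lee_fin => <-.
  - by apply: integral_ge0 => x _; rewrite lee_fin mul1r one_sub_expRN_ge0// mulr_ge0.
  - by move=> x; rewrite mulr_ge0.
  - exact: measurable_funM.
  - exact: Hq.
have S1 (s : R) : 0 <= s -> (\int[P]_x (Num.sqrt (p x) * (1 - expR (- (s * q x))))%:E =
    (m * (1 - psi s))%:E)%E.
  move=> s0.
  transitivity (\int[P]_x ((1 - expR (- (s * q x))) * Num.sqrt (p x))%:E)%E.
    by apply: eq_integral => x _; rewrite mulrC.
  rewrite (@sqrt_from_laplace _ _ _ P _ _ _ _ P (cst (1 - psi s)) p)//=.
  - under eq_integral do rewrite EFinM.
    rewrite ge0_integralZl//=; last 2 first.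
    + by apply/measurable_EFinP; exact: measurable_fun_sqrt.
    + by rewrite lee_fin psi1.
    by rewrite Hm -EFinM mulrC.
  - by move=> x; rewrite one_sub_expRN_ge0// mulr_ge0.
  - by apply: mexp; exact: measurable_funM.
  - by move=> _; exact: psi1.
  - move=> t t0.
    rewrite (@integral_scaled_one_sub _ _ (phi t))//; last 4 first.
    + exact: psi1.
    + by move=> x; rewrite mulr_ge0.
    + exact: measurable_funM.
    + exact: Hp.
    rewrite (@integral_one_sub _ _ _ P _ _ (1 - psi s) (phi t - phi t * psi s)).
    + by congr EFin; ring.
    + by move=> x; rewrite one_sub_expRN_ge0// mulr_ge0.
    + by move=> x; rewrite expRN_itv// mulr_ge0.
    + by apply: mexp; exact: measurable_funM.
    + by apply: measurable_fun_expN; exact: measurable_funM.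
    + rewrite -[RHS]/((1 - psi s)%:E) -[1 - psi s]mul1r -(@integral_scaled_one_sub _ (fun x => s * q x))//.
      * by apply: eq_integral => x _; rewrite mul1r.
      * by move=> x; rewrite mulr_ge0.
      * exact: measurable_funM.
      * exact: Hq.
    + transitivity (\int[P]_x (expR (- (t * p x)) * (1 - expR (- (s * q x))))%:E)%E.
        by apply: eq_integral => x _; rewrite mulrC.
      apply: integral_one_sub => //.
      * by move=> x; rewrite expRN_itv// mulr_ge0.
      * by apply: measurable_fun_expN; exact: measurable_funM.
      * by apply: measurable_fun_expN; exact: measurable_funM.
      * exact: Hp.
      * rewrite -H//; apply: eq_integral => x _; congr EFin.
        by rewrite -expRD; congr expR; ring.
rewrite (@sqrt_from_laplace _ _ _ P _ _ _ _ P (cst m) q)//=.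
- under eq_integral do rewrite EFinM.
  by rewrite ge0_integralZl//=; apply/measurable_EFinP; exact: measurable_fun_sqrt.
- exact: measurable_fun_sqrt.
- move=> s s0; rewrite S1// (@integral_scaled_one_sub _ _ (psi s))//.
  + by move=> x; rewrite mulr_ge0.
  + exact: measurable_funM.
  + exact: Hq.
Qed.
End Prob.
End GammaLaws.

(** * Matrix-valued measurable functions *)

Section MeasurableMatrix.
Context {R : realType} d (T : measurableType d).

Definition measurable_mx m n (f : T -> 'M[R]_(m, n)) :=
  forall i j, measurable_fun setT (fun w => f w i j).

Lemma measurable_mx_cst m n (A : 'M[R]_(m, n)) : measurable_mx (fun=> A).
Proof. by move=> i j; exact: measurable_cst. Qed.

Lemma measurable_mx_tr m n (f : T -> 'M[R]_(m, n)) :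
  measurable_mx f -> measurable_mx (fun w => (f w)^T).
Proof.
by move=> mf i j; under eq_fun do rewrite mxE; exact: mf.
Qed.

Lemma measurable_mx_mul m n p (f : T -> 'M[R]_(m, n)) (g : T -> 'M[R]_(n, p)) :
  measurable_mx f -> measurable_mx g -> measurable_mx (fun w => f w *m g w).
Proof.
move=> mf mg i j; under eq_fun do rewrite mxE.
by apply: measurable_sum => l; exact: measurable_funM.
Qed.

End MeasurableMatrix.

(** * Independence of one coordinate from the others *)

Section PeelCoordinate.
Context {R : realType} d (T : measurableType d) (P : probability T R).

(** Independence is only kept for the full index set: smaller families are recovered
    by taking the whole line for the other coordinates. *)
Definition std_normal m (Z : 'I_m -> {RV P >-> R}) : Prop :=
  (forall B : 'I_m -> set R, (forall i, measurable (B i)) ->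
    P [set w | forall i, B i (Z i w)] = (\prod_i P (Z i @^-1` B i))%E) /\
  (forall i (B : set R), measurable B -> P (Z i @^-1` B) = normal_prob 0 1 B).

Lemma standard_normal_vector_std m (Z : 'I_m -> {RV P >-> R}) :
  standard_normal_vector Z -> std_normal Z.
Proof.
move=> [indep dist]; split => [B mB|i B mB]; last by rewrite -(dist i).
have := indep [set: 'I_m]%SET B mB.
rewrite (eq_bigl xpredT); last by move=> i; rewrite inE.
move=> <-; congr (P _); apply/seteqP; split => w /= H.
  by move=> i _; exact: H.
by move=> i; apply: (H i); rewrite /= inE.
Qed.

Variables (m : nat) (Z : 'I_m.+1 -> {RV P >-> R}).
Hypothesis stdZ : std_normal Z.

Definition tailRV (i : 'I_m) : {RV P >-> R} := Z (lift ord0 i).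

Lemma std_normal_tail : std_normal tailRV.
Proof.
move: stdZ => [indep dist]; split => [B mB|i B mB]; last exact: dist.
pose B' (i : 'I_m.+1) : set R := if unlift ord0 i is Some j then B j else setT.
have mB' i : measurable (B' i) by rewrite /B'; case: unlift.
have := indep B' mB'.
rewrite big_ord_recl {2}/B' unlift_none preimage_setT probability_setT mul1e.
rewrite (eq_bigr (fun i => P (tailRV i @^-1` B i))); last first.
  by move=> i _; rewrite /B' liftK.
move=> <-; congr (P _); apply/seteqP; split => w /= H.
  by move=> i; rewrite /B'; case: unliftP => [j ->|//]; exact: H.
by move=> i; have := H (lift ord0 i); rewrite /B' liftK.
Qed.

Definition tail (w : T) : m.-tuple R := [tuple tailRV i w | i < m].

Lemma measurable_tail : measurable_fun setT tail.
Proof.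
apply/measurable_fun_tnthP => i.
rewrite (_ : _ \o _ = tailRV i) //.
by apply/funext => w /=; rewrite tnth_mktuple.
Qed.

HB.instance Definition _ := isMeasurableFun.Build _ _ _ _ tail measurable_tail.

Definition rectangle : set (set (m.-tuple R)) :=
  [set C | exists2 B : 'I_m -> set R, (forall i, measurable (B i)) &
    C = [set t | forall i, B i (tnth t i)]].

(** Unlike the cylinders that define it, the rectangles generating this sigma-algebra
    are closed under intersection, as uniqueness of measures requires. *)
Lemma measurable_tuple_rectangle : measurable = <<s rectangle >>.
Proof.
apply/seteqP; split.
  apply: smallest_sub; first exact: smallest_sigma_algebra.
  rewrite -bigcup_seq => A [i _] [B mB <-].
  apply: sub_sigma_algebra; exists (fun j => if j == i then B else setT).
    by move=> j; case: ifP.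
  rewrite setTI; apply/seteqP; split => t /=.
    by move=> Bt j; case: eqP => // ->.
  by move=> /(_ i); rewrite eqxx.
apply: smallest_sub; first exact: sigma_algebra_measurable.
move=> _ [B mB ->].
rewrite (_ : [set t | _] = \bigcap_(i in [set: 'I_m]) ((fun t => tnth t i) @^-1` B i)).
  apply: fin_bigcap_measurable => [|i _]; first exact: finite_finset.
  by rewrite -[X in measurable X]setTI; exact: measurable_tnth.
by apply/seteqP; split => t /= H i; [move=> _|]; exact: H.
Qed.

(** For fixed A both sides are finite measures in C that agree on rectangles. *)
Lemma indep_head_tail (A : set R) (C : set (m.-tuple R)) :
  measurable A -> measurable C ->
  (P (Z ord0 @^-1` A `&` tail @^-1` C) = normal_prob 0 1 A * P (tail @^-1` C))%E.
Proof.
move=> mA mC; have [indep dist] := stdZ.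
have mZA : measurable (Z ord0 @^-1` A) by rewrite -[X in measurable X]setTI; exact: measurable_funP.
pose m10 : {measure set (m.-tuple R) -> \bar R} :=
  pushforward (mrestr P mZA) tail.
have mt : measurable_fun setT tail by exact: measurable_tail.
pose m1 := m10 mt.
have fA : normal_prob 0 1 A \is a fin_num by exact: fin_num_measure.
have A0 : 0 <= fine (normal_prob 0 1 A) by exact: fine_ge0.
pose m2 : {measure set (m.-tuple R) -> \bar R} :=
  mscale (NngNum A0) (distribution P tail).
have -> : (normal_prob 0 1 A * P (tail @^-1` C))%E = m2 C.
  by rewrite /m2/= /mscale/= fineK.
have -> : P (Z ord0 @^-1` A `&` tail @^-1` C) = m1 C.
  by rewrite /m1 /m10/= /pushforward /mrestr setIC.
apply: (@measure_unique _ _ _ rectangle (fun=> setT)) => //.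
- exact: measurable_tuple_rectangle.
- move=> _ _ [B1 mB1 ->] [B2 mB2 ->]; exists (fun i => B1 i `&` B2 i).
    by move=> i; exact: measurableI.
  apply/seteqP; split => t /=; first by move=> [H1 H2] i; split.
  by move=> H; split => i; have [] := H i.
- by move=> _; exists (fun=> setT) => //; apply/seteqP; split.
- by apply/seteqP; split => // t _; exists 0%N.
- move=> _ [B mB ->]; rewrite /m1 /m10 /m2 /= /mscale /pushforward /mrestr /= fineK//.
  have H1 := std_normal_tail.1 B mB.
  pose B' (i : 'I_m.+1) : set R := if unlift ord0 i is Some j then B j else A.
  have mB' i : measurable (B' i) by rewrite /B'; case: unlift.
  have H2 := indep B' mB'.
  rewrite big_ord_recl {2}/B' unlift_none dist// in H2.
  transitivity (P [set w | forall i, B' i (Z i w)]).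
    congr (P _); apply/seteqP; split => w /=.
      move=> [H HA] i; rewrite /B'; case: unliftP => [j ->|->//].
      by have := H j; rewrite tnth_mktuple.
    move=> H; split; last by have := H ord0; rewrite /B' unlift_none.
    by move=> i; rewrite tnth_mktuple; have := H (lift ord0 i); rewrite /B' liftK.
  rewrite H2; congr (_ * _)%E.
  rewrite (eq_bigr (fun i => P (tailRV i @^-1` B i))); last first.
    by move=> i _; rewrite /B' liftK.
  rewrite -H1; congr (P _); apply/seteqP; split => w /= H i.
    by rewrite tnth_mktuple.
  by have := H i; rewrite tnth_mktuple.
- move=> _; rewrite /m1 /m10 /= /pushforward /mrestr preimage_setT setTI.
  by rewrite (le_lt_trans (probability_le1 _ _))// ltry.
Qed.

(** The joint law of the first coordinate and of the others is a product measure;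
    integrate the first coordinate first. *)
Lemma integral_peel (f : R * m.-tuple R -> \bar R) :
  measurable_fun setT f -> (forall z, 0 <= f z)%E ->
  (\int[P]_w f (Z ord0 w, tail w) =
   \int[P]_w \int[normal_prob 0 1]_x f (x, tail w))%E.
Proof.
move=> mf f0.
pose Y w : measurableTypeR R * m.-tuple R := (Z ord0 w, tail w).
have mY : measurable_fun setT Y.
  by apply: measurable_fun_pair; [exact: (measurable_funP (Z ord0))|exact: measurable_tail].
pose muY0 : {measure set (measurableTypeR R * m.-tuple R) -> \bar R} := pushforward P Y.
pose muY := muY0 mY.
transitivity (\int[muY]_z f z)%E.
  by rewrite /muY /muY0 ge0_integral_pushforward//.
transitivity (\int[normal_prob 0 1 \x distribution P tail]_z f z)%E.
  apply: eq_measure_integral => A mA _; apply/esym/product_measure_unique => //.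
  move=> B C mB mC; rewrite /muY /muY0 /= /pushforward.
  rewrite -[RHS]indep_head_tail//.
rewrite fubini_tonelli2// ge0_integral_distribution//.
  exact: measurable_fun_fubini_tonelli_G.
by move=> y; apply: integral_ge0.
Qed.
End PeelCoordinate.

(** * One-dimensional Gaussian integrals *)

Section Gauss1D.
Context {R : realType}.
Notation mu := (@lebesgue_measure R).

Lemma ge0_integral_normal_prob (m s : R) (f : R -> \bar R) :
  measurable_fun setT f -> (forall x, 0 <= f x)%E ->
  (\int[normal_prob m s]_x f x = \int[mu]_x (f x * (normal_pdf m s x)%:E))%E.
Proof.
move=> mf f0; have dom := normal_prob_dominates m s.
rewrite -(Radon_Nikodym_SigmaFinite.change_of_variables dom)//.
have fi := Radon_Nikodym_SigmaFinite.f_integrable dom.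
apply: ae_eq_integral => //.
- by apply: emeasurable_funM => //; exact: measurable_int fi.
- by apply: emeasurable_funM => //; apply/measurable_EFinP; exact: measurable_normal_pdf.
- apply: ae_eqe_mul2l; apply: integral_ae_eq => //.
    by apply/measurable_EFinP; exact: measurable_normal_pdf.
  by move=> E _ mE; rewrite -Radon_Nikodym_SigmaFinite.f_integral.
Qed.

(** Completing the square turns the integrand into a multiple of the normal density
    with mean - b / alpha and variance 1 / alpha. *)
Lemma integral_normal_prob_quadratic (alpha b c : R) : 0 < alpha ->
  (\int[normal_prob 0 1]_x (expR (- ((alpha - 1) * x ^+ 2 + b * x *+ 2 + c) / 2))%:E =
   ((Num.sqrt alpha)^-1 * expR (- (c - b ^+ 2 / alpha) / 2))%:E)%E.
Proof.
move=> a0.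
have sa : 0 < Num.sqrt alpha by rewrite sqrtr_gt0.
set s := (Num.sqrt alpha)^-1.
have s0 : 0 < s by rewrite invr_gt0.
have s2 : s ^+ 2 = alpha^-1 by rewrite exprVn sqr_sqrtr// ltW.
have mq : measurable_fun setT (fun x : R => expR (- ((alpha - 1) * x ^+ 2 + b * x *+ 2 + c) / 2)).
  apply: measurableT_comp => //; apply: measurable_funM => //.
  apply: measurableT_comp => //; apply: measurable_funD => //.
  apply: measurable_funD; first by apply: measurable_funM => //; exact: measurable_funX.
  under eq_fun do rewrite -mulr_natr.
  by apply: measurable_funM => //; exact: measurable_funM.
rewrite ge0_integral_normal_prob; last 2 first.
- exact/measurable_EFinP.
- by move=> x; rewrite lee_fin expR_ge0.
set k := s * expR _.
transitivity (k%:E * \int[mu]_x (normal_pdf (- b / alpha) s x)%:E)%E; last first.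
  by rewrite integral_normal_pdf mule1.
rewrite -ge0_integralZl//=; last 3 first.
- by apply/measurable_EFinP; exact: measurable_normal_pdf.
- by move=> x _; rewrite lee_fin normal_pdf_ge0.
- by rewrite lee_fin mulr_ge0 ?expR_ge0 ?ltW.
apply: eq_integral => x _; rewrite -!EFinM; congr EFin; rewrite /k.
rewrite !normal_pdfE ?gt_eqF// /normal_peak /normal_fun.
rewrite [LHS](_ : _ = (Num.sqrt (1 ^+ 2 * pi *+ 2))^-1 *
  (expR (- ((alpha - 1) * x ^+ 2 + b * x *+ 2 + c) / 2) *
   expR (- (x - 0) ^+ 2 / (1 ^+ 2 *+ 2)))); last by ring.
rewrite [RHS](_ : _ = (s * (Num.sqrt (s ^+ 2 * pi *+ 2))^-1) *
  (expR (- (c - b ^+ 2 / alpha) / 2) *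
   expR (- (x - - b / alpha) ^+ 2 / (s ^+ 2 *+ 2)))); last by ring.
rewrite -!expRD; congr (_ * expR _).
  rewrite -!mulrnAr (sqrtrM _ (sqr_ge0 s)) sqrtr_sqr ger0_norm ?ltW// expr1n mul1r.
  by rewrite invfM mulrA mulfV ?mul1r ?gt_eqF.
rewrite s2; field.
by rewrite gt_eqF.
Qed.

End Gauss1D.

(** * Quadratic forms and Schur complements *)

Section QuadraticForms.
Context {R : realType}.

Definition quad n (M : 'M[R]_n) (v : 'cV[R]_n) : R := (v^T *m M *m v) 0 0.

Definition posdef n (M : 'M[R]_n) := M^T = M /\ forall v, v != 0 -> 0 < quad M v.

Lemma quad_block m (alpha : R) (b : 'rV[R]_m) (C : 'M[R]_m) (x : R) (z : 'cV[R]_m) :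
  quad (block_mx alpha%:M b b^T C) (col_mx x%:M z) =
  alpha * x ^+ 2 + (b *m z) 0 0 * x *+ 2 + quad C z.
Proof.
rewrite /quad tr_col_mx -mulmxA mul_block_col mul_row_col tr_scalar_mx.
rewrite !mul_mx_scalar !mul_scalar_mx mulmxDr -scalemxAr -trmx_mul mulmxA.
rewrite !mxE eqxx mulr1n; set y := \sum_j _; set w := \sum_j _.
by ring.
Qed.

Lemma quad_schur m (alpha : R) (b : 'rV[R]_m) (C : 'M[R]_m) (z : 'cV[R]_m) :
  quad (C - alpha^-1 *: (b^T *m b)) z = quad C z - ((b *m z) 0 0) ^+ 2 / alpha.
Proof.
rewrite /quad mulmxBr mulmxBl -scalemxAr -scalemxAl 3!mxE; congr (_ - _).
have -> : z^T *m (b^T *m b) *m z = (b *m z)^T *m (b *m z).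
  by rewrite trmx_mul !mulmxA.
set y := b *m z.
rewrite mxE mulrC; congr (_ * _).
by rewrite mxE big_ord1 mxE expr2.
Qed.

(** Block elimination of the lower left corner. *)
Lemma det_schur m (alpha : R) (b : 'rV[R]_m) (C : 'M[R]_m) : alpha != 0 ->
  \det (block_mx alpha%:M b b^T C) = alpha * \det (C - alpha^-1 *: (b^T *m b)).
Proof.
move=> a0.
have -> : block_mx alpha%:M b b^T C = block_mx 1%:M 0 (alpha^-1 *: b^T) 1%:M *m
   block_mx alpha%:M b 0 (C - alpha^-1 *: (b^T *m b)).
  rewrite mulmx_block !mul1mx !mul0mx !addr0.
  rewrite mul_mx_scalar scalerA mulfV// scale1r -scalemxAl. 
  by rewrite addrC subrK.
by rewrite det_mulmx det_lblock !det1 !mul1r det_ublock det_scalar1.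
Qed.

(** The form of the Schur complement at v is the full form at the vector that extends
    v by its minimizing first coordinate - (b v) / alpha. *)
Lemma posdef_block m (alpha : R) (b : 'rV[R]_m) (C : 'M[R]_m) :
  posdef (block_mx alpha%:M b b^T C) ->
  0 < alpha /\ posdef (C - alpha^-1 *: (b^T *m b)).
Proof.
move=> [sM pM].
have a0 : 0 < alpha.
  have := pM (col_mx 1%:M 0); rewrite quad_block /quad !mulmx0 !mxE mul0r mul0rn !addr0.
  rewrite expr1n mulr1; apply.
  by rewrite -col_mx0; apply/eqP => /eq_col_mx[/eqP]; rewrite oner_eq0.
split=> //; split.
  move: sM; rewrite tr_block_mx => /eq_block_mx[_ _ _ sC].
  by rewrite linearB linearZ/= trmx_mul trmxK sC.
move=> v v0; rewrite quad_schur.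
have := pM (col_mx (- (b *m v) 0 0 / alpha)%:M v).
rewrite quad_block.
have -> : alpha * (- (b *m v) 0 0 / alpha) ^+ 2 +
    (b *m v) 0 0 * (- (b *m v) 0 0 / alpha) *+ 2 + quad C v =
    quad C v - (b *m v) 0 0 ^+ 2 / alpha.
  by field; rewrite gt_eqF.
apply; rewrite -col_mx0; apply/eqP => /eq_col_mx[_ /eqP]; exact/negP.
Qed.

Lemma symmetric_blockE m (M : 'M[R]_(1 + m)) : M^T = M ->
  M = block_mx (M 0 0)%:M (ursubmx M) (ursubmx M)^T (drsubmx M).
Proof.
move=> sM; rewrite -{1}(submxK M); congr block_mx.
  apply/matrixP => i j; rewrite !ord1 !mxE eqxx mulr1n; congr (M _ _); exact/val_inj.
by rewrite -{1}sM trmx_ursub.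
Qed.

End QuadraticForms.

(** * Laplace transforms of quadratic forms in a standard normal vector *)

Section GaussLaplace.
Context {R : realType}.

(** Factor the block matrix with identity diagonal blocks and off-diagonal blocks - A
    and B in two ways. *)
Lemma det_1addC m n (A : 'M[R]_(m, n)) (B : 'M[R]_(n, m)) :
  \det (1%:M + A *m B) = \det (1%:M + B *m A).
Proof.
have E1 : block_mx 1%:M (- A) B 1%:M =
    block_mx 1%:M 0 B 1%:M *m block_mx 1%:M (- A) 0 (1%:M + B *m A).
  rewrite mulmx_block ?(mul1mx, mulmx1, mul0mx, mulmx0) ?(addr0, add0r) mulmxN.
  by rewrite addrC addrK.
have E2 : block_mx 1%:M (- A) B 1%:M =
    block_mx 1%:M (- A) 0 1%:M *m block_mx (1%:M + A *m B) 0 B 1%:M.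
  rewrite mulmx_block ?(mul1mx, mulmx1, mul0mx, mulmx0) ?(addr0, add0r) mulNmx.
  by rewrite addrK.
have := congr1 determinant E1; rewrite {1}E2 !det_mulmx !det_lblock !det_ublock.
by rewrite !det1 !mul1r !mulr1.
Qed.

Lemma dotvE n (u v : 'cV[R]_n) : dotv u v = \sum_i u i 0 * v i 0.
Proof. by rewrite /dotv mxE; apply: eq_bigr => i _; rewrite mxE. Qed.

Lemma dotv_ge0 n (u : 'cV[R]_n) : 0 <= dotv u u.
Proof. by rewrite dotvE; apply: sumr_ge0 => i _; rewrite -expr2 sqr_ge0. Qed.

Lemma dotv_gt0 n (u : 'cV[R]_n) : u != 0 -> 0 < dotv u u.
Proof.
move=> u0; rewrite lt_neqAle dotv_ge0 andbT eq_sym; apply: contraNneq u0.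
rewrite dotvE => /psumr_eq0P H; apply/eqP/matrixP => i j.
rewrite ord1 mxE; apply/eqP; rewrite -sqrf_eq0 expr2; apply/eqP; apply: H => //.
by move=> k _; rewrite -expr2 sqr_ge0.
Qed.

Lemma quadD n (M N : 'M[R]_n) v : quad (M + N) v = quad M v + quad N v.
Proof. by rewrite /quad mulmxDr mulmxDl mxE. Qed.

Lemma quad1 n (v : 'cV[R]_n) : quad 1%:M v = dotv v v.
Proof. by rewrite /quad mulmx1. Qed.

Lemma quad_gram m n (K : 'M[R]_(m, n)) v : quad (K^T *m K) v = dotv (K *m v) (K *m v).
Proof. by rewrite /quad /dotv trmx_mul !mulmxA. Qed.

Lemma posdef_1gram m n (K : 'M[R]_(m, n)) : posdef (1%:M + K^T *m K).
Proof.
split; first by rewrite linearD/= trmx1 trmx_mul trmxK.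
move=> v v0; rewrite quadD quad1 quad_gram.
by rewrite ltr_pwDl ?dotv_gt0 ?dotv_ge0.
Qed.

Lemma block_mx_sub1 m (alpha : R) (b : 'rV[R]_m) (b' : 'cV[R]_m) (C : 'M[R]_m) :
  block_mx alpha%:M b b' C - 1%:M = block_mx (alpha - 1)%:M b b' (C - 1%:M).
Proof.
by rewrite scalar_mx_block opp_block_mx add_block_mx !oppr0 !addr0 raddfB.
Qed.

Context d (T : measurableType d) (P : probability T R).

Lemma random_vectorS m (Z : 'I_m.+1 -> {RV P >-> R}) w :
  random_vector Z w = col_mx (Z ord0 w)%:M (random_vector (tailRV Z) w) :> 'cV_(1 + m).
Proof.
apply/colP => i; rewrite -[i](@splitK 1 m); case: (@fintype.split 1 m i) => j /=.
  rewrite col_mxEu !mxE ord1 eqxx mulr1n; congr (Z _ w); exact/val_inj.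
by rewrite col_mxEd !mxE; congr (Z _ w); exact/val_inj.
Qed.

Lemma measurable_random_vector m (Z : 'I_m -> {RV P >-> R}) :
  measurable_mx (random_vector Z).
Proof.
move=> i j; rewrite (_ : (fun w => _) = Z i).
  exact: measurable_funP.
by apply/funext => w; rewrite mxE.
Qed.

(** Integrating out the first coordinate with the others fixed replaces M by its Schur
    complement, and the factor 1 / sqrt alpha it produces is the one by which the
    determinants differ. *)
Lemma integral_gauss_quad m (Z : 'I_m -> {RV P >-> R}) (M : 'M[R]_m) :
  std_normal Z -> posdef M ->
  (\int[P]_w (expR (- quad (M - 1%:M) (random_vector Z w) / 2))%:E =
   ((Num.sqrt (\det M))^-1)%:E)%E.
Proof.
elim: m => [|m IH] in Z M *.
  move=> _ _; rewrite det_mx00 sqrtr1 invr1.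
  transitivity (\int[P]_w (cst 1%E w))%E; last first.
    by rewrite integral_cst//= probability_setT mule1.
  apply: eq_integral => w _.
  by rewrite /quad mxE big_ord0 oppr0 mul0r expR0.
move=> stdZ pM; have ME := @symmetric_blockE R m M pM.1.
move: ME pM; set alpha := M 0 0; set b := ursubmx _; set C := drsubmx _ => ME.
rewrite ME => /posdef_block[a0 pS].
rewrite det_schur ?gt_eqF// sqrtrM ?ltW// invfM.
set S := C - _ in pS *.
pose tcol (t : m.-tuple R) : 'cV[R]_m := \col_i tnth t i.
have mtcol : measurable_mx tcol.
  move=> i j; rewrite (_ : (fun w => _) = (fun t => tnth t i)).
    exact: measurable_tnth.
  by apply/funext => w; rewrite mxE.
pose f (z : R * m.-tuple R) : \bar R :=
  (expR (- ((alpha - 1) * z.1 ^+ 2 + (b *m tcol z.2) 0 0 * z.1 *+ 2 +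
            quad (C - 1%:M) (tcol z.2)) / 2))%:E.
have tail_col w : tcol (tail Z w) = random_vector (tailRV Z) w.
  by apply/colP => i; rewrite !mxE tnth_mktuple.
have mb : measurable_fun setT (fun t => (b *m tcol t) 0 0).
  by apply: measurable_mx_mul => //; exact: measurable_mx_cst.
have mC : measurable_fun setT (fun t => quad (C - 1%:M) (tcol t)).
  apply: measurable_mx_mul => //; apply: measurable_mx_mul; last exact: measurable_mx_cst.
  exact: measurable_mx_tr.
have mf : measurable_fun setT f.
  apply/measurable_EFinP; apply: measurableT_comp => //; apply: measurable_funM => //.
  apply: measurableT_comp => //; apply: measurable_funD; last first.
    exact: (measurableT_comp mC).
  apply: measurable_funD.
    by apply: measurable_funM => //; apply: measurable_funX.
  under eq_fun do rewrite -mulr_natr.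
  apply: measurable_funM => //; apply: measurable_funM => //.
  exact: (measurableT_comp mb).
transitivity (\int[P]_w f (Z ord0 w, tail Z w))%E.
  apply: eq_integral => w _; rewrite /f /= tail_col random_vectorS.
  by rewrite block_mx_sub1 quad_block.
rewrite integral_peel//; last by move=> z; rewrite lee_fin expR_ge0.
rewrite /f /=; under eq_integral do rewrite tail_col integral_normal_prob_quadratic//.
under eq_integral do rewrite EFinM.
rewrite ge0_integralZl//=; last first.
- apply/measurable_EFinP; apply: measurableT_comp => //; apply: measurable_funM => //.
  apply: measurableT_comp => //; apply: measurable_funB.
    apply: measurable_mx_mul; last exact: measurable_random_vector.
    by apply: measurable_mx_mul; [apply: measurable_mx_tr; exact: measurable_random_vector|exact: measurable_mx_cst].
  apply: measurable_funM => //; apply: measurable_funX.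
  by apply: measurable_mx_mul; [exact: measurable_mx_cst|exact: measurable_random_vector].
rewrite EFinM; congr (_ * _)%E.
rewrite -(IH _ S (std_normal_tail stdZ) pS); apply: eq_integral => w _.
congr ((expR (- _ / 2))%:E).
by rewrite /S addrAC quad_schur.
Qed.

Lemma integral_gauss_gram m n (Z : 'I_m -> {RV P >-> R}) (K : 'M[R]_(n, m)) :
  std_normal Z ->
  (\int[P]_w (expR (- dotv (K *m random_vector Z w) (K *m random_vector Z w) / 2))%:E =
   ((Num.sqrt (\det (1%:M + K *m K^T)))^-1)%:E)%E.
Proof.
move=> stdZ; rewrite det_1addC -(integral_gauss_quad stdZ (posdef_1gram K)).
by apply: eq_integral => w _; rewrite addrC addKr quad_gram.
Qed.

(** Scale and stack g and H into one matrix K. The orthogonality g H^T = 0 makes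
    K K^T block diagonal, so the joint Laplace transform factors; this replaces the
    independence of g Z and H Z. *)
Lemma integral_gauss_pair m n (Z : 'I_m -> {RV P >-> R}) (g : 'rV[R]_m)
    (H : 'M[R]_(n, m)) (s t : R) :
  std_normal Z -> g *m H^T = 0 -> 0 <= s -> 0 <= t ->
  (\int[P]_w (expR (- (s * ((g *m random_vector Z w) 0 0) ^+ 2 +
      t * dotv (H *m random_vector Z w) (H *m random_vector Z w))%R))%:E =
   ((Num.sqrt (1 + 2 * s * (g *m g^T) 0 0))^-1 *
    (Num.sqrt (\det (1%:M + (2 * t) *: (H *m H^T))))^-1)%:E)%E.
Proof.
move=> stdZ gH s0 t0.
have s20 : 0 <= 2 * s by rewrite mulr_ge0.
have t20 : 0 <= 2 * t by rewrite mulr_ge0.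
(* The factors 2 compensate the 1/2 in the exponent of the Gaussian formula. *)
pose K := col_mx (Num.sqrt (2 * s) *: g) (Num.sqrt (2 * t) *: H).
have := integral_gauss_gram K stdZ.
have -> : 1%:M + K *m K^T =
    block_mx ((1 + 2 * s * (g *m g^T) 0 0)%:M) 0 0 (1%:M + (2 * t) *: (H *m H^T)).
  have Hg : H *m g^T = 0 by rewrite -[LHS]trmxK trmx_mul trmxK gH trmx0.
  rewrite /K tr_col_mx mul_col_row !linearZ/= -!scalemxAl !scalemxAr.
  rewrite -!scalemxAr gH Hg !scaler0.
  rewrite !scalerA -!expr2 !sqr_sqrtr//.
  rewrite scalar_mx_block add_block_mx !addr0; congr block_mx.
  by apply/matrixP => i j; rewrite !ord1 !mxE eqxx !mulr1n.
rewrite det_ublock det_scalar1 sqrtrM ?invfM; last first.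
  rewrite addr_ge0// mulr_ge0// mxE; apply: sumr_ge0 => i _.
  by rewrite mxE -expr2 sqr_ge0.
move=> <-; apply: eq_integral => w _; congr (expR _)%:E.
set z := random_vector Z w.
have -> : dotv (K *m z) (K *m z) = 2 * s * (g *m z) 0 0 ^+ 2 + 2 * t * dotv (H *m z) (H *m z).
  rewrite /K mul_col_mx /dotv tr_col_mx mul_row_col mxE -!scalemxAl !linearZ/=.
  rewrite -!scalemxAl !scalerA -!expr2 !sqr_sqrtr//.
  by rewrite mxE [in X in X + _]mxE big_ord1 !mxE.
by field.
Qed.

End GaussLaplace.

(** * Moments of linear forms in a standard normal vector *)

Section Moments.
Context {R : realType}.
Notation mu := (@lebesgue_measure R).

(** Both Lebesgue measure and the centred normal density are even. *)
Lemma ge0_integral_normal_probN (f : R -> \bar R) :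
  measurable_fun setT f -> (forall x, 0 <= f x)%E ->
  (\int[normal_prob 0 1]_x f (- x)%R = \int[normal_prob 0 1]_x f x)%E.
Proof.
move=> mf f0.
have mN : measurable_fun setT (fun x : R => f (- x)%R).
  by apply: (measurableT_comp mf); exact: oppr_measurable.
have mpdf := @measurable_normal_pdf R 0 1.
rewrite !ge0_integral_normal_prob//.
pose g (x : R) := (f x * (normal_pdf 0 1 x)%:E)%E.
have g0 x : (0 <= g x)%E by rewrite mule_ge0// lee_fin normal_pdf_ge0.
have mg : measurable_fun setT g by apply: emeasurable_funM => //; exact/measurable_EFinP.
transitivity (\int[mu]_x (g \o (-%R : R -> measurableTypeR R)) x)%E.
  apply: eq_integral => x _; rewrite /g /=; congr (_ * _%:E)%E.
  by rewrite !normal_pdfE// /normal_fun !subr0 sqrrN.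
have mphi : measurable_fun setT (-%R : measurableTypeR R -> measurableTypeR R).
  exact: oppr_measurable.
have := @ge0_integral_pushforward _ _ _ _ R _ mphi mu setT g measurableT mg.
rewrite preimage_setT => <-; last by move=> x _; exact: g0.
apply: eq_measure_integral => A mA _; exact: lebesgue_measureN.
Qed.

Context d (T : measurableType d) (P : probability T R).

Section StdNormal.
Variables (m : nat) (Z : 'I_m -> {RV P >-> R}) (stdZ : std_normal Z).
Let z := random_vector Z.

Lemma measurable_mx_lin p (g : 'M[R]_(p, m)) : measurable_mx (fun w => g *m z w).
Proof. by apply: measurable_mx_mul; [exact: measurable_mx_cst|exact: measurable_random_vector]. Qed.

(** The square of a linear form has Laplace transform (1 + 2 c s)^(-1/2) with
    c = g g^T; differentiate at 0. *)
Lemma integral_lin_sqr (g : 'rV[R]_m) :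
  (\int[P]_w (((g *m z w) 0 0) ^+ 2)%:E = ((g *m g^T) 0 0)%:E)%E.
Proof.
set c := (g *m g^T) 0 0.
have c0 : 0 <= c.
  by rewrite /c mxE; apply: sumr_ge0 => i _; rewrite mxE -expr2 sqr_ge0.
have D : is_derive (0 : R) 1 (fun s => 1 - (1 + (2 * c) * s) `^ (- 2^-1)) c.
  by have := is_derive_laplace (2 * c) 2^-1; rewrite mulrAC divff// mul1r.
have mq : measurable_fun setT (fun w => (g *m z w) 0 0 ^+ 2).
  by apply: measurable_funX; exact: measurable_mx_lin.
rewrite -(@mean_from_laplace _ _ _ P (cst 1) (fun w => (g *m z w) 0 0 ^+ 2) _ _ _ _ _ mq _ _ D)//.
- by apply: eq_integral => w _; rewrite mul1r.
- by move=> w; exact: sqr_ge0.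
- move=> s s0; rewrite (@integral_scaled_one_sub _ _ _ P _ _ ((1 + 2 * c * s) `^ (- 2^-1))) ?mul1r//.
  + by move=> w; rewrite mulr_ge0// sqr_ge0.
  + exact: measurable_funM.
  + have := integral_gauss_pair (n := 0) stdZ (g := g) (H := 0) (s := s) (t := 0).
    rewrite trmx0 mulmx0 => /(_ erefl s0 (lexx _)).
    rewrite det_mx00 sqrtr1 invr1 mulr1 -/c.
    rewrite powRN powR12_sqrt; last by rewrite addr_ge0// mulr_ge0// mulr_ge0.
    rewrite [2 * c * s]mulrAC => <-.
    by apply: eq_integral => w _; rewrite mul0r addr0.
- by rewrite mulr0 addr0 powR1 subrr.
Qed.

Lemma integral_dotv_lin p (K : 'M[R]_(p, m)) :
  (\int[P]_w (dotv (K *m z w) (K *m z w))%:E = (\tr (K *m K^T))%:E)%E.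
Proof.
under eq_integral do rewrite dotvE -sumEFin.
rewrite ge0_integral_sum//=; last 2 first.
- move=> i; apply/measurable_EFinP; apply: measurable_funM; exact: measurable_mx_lin.
- by move=> i w _; rewrite lee_fin -expr2 sqr_ge0.
rewrite /mxtrace -sumEFin; apply: eq_bigr => i _.
transitivity (\int[P]_w (((row i K *m z w) 0 0) ^+ 2)%:E)%E.
  by apply: eq_integral => w _; rewrite -row_mul [in RHS]mxE expr2.
rewrite integral_lin_sqr; congr EFin.
by rewrite !mxE; apply: eq_bigr => j _; rewrite !mxE.
Qed.

Lemma integrable_lin_sqr (g : 'rV[R]_m) :
  P.-integrable setT (fun w => (((g *m z w) 0 0) ^+ 2)%:E).
Proof.
apply/integrableP; split.
  by apply/measurable_EFinP; apply: measurable_funX; exact: measurable_mx_lin.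
under eq_integral do rewrite gee0_abs ?lee_fin ?sqr_ge0//.
by rewrite integral_lin_sqr ltry.
Qed.

(** Polarization of the second moments. *)
Lemma integral_linM (g h : 'rV[R]_m) :
  (\int[P]_w ((g *m z w) 0 0 * (h *m z w) 0 0)%:E = ((g *m h^T) 0 0)%:E)%E.
Proof.
have E : (\int[P]_w (4^-1%:E * ((((g + h) *m z w) 0 0 ^+ 2)%:E -
    (((g - h) *m z w) 0 0 ^+ 2)%:E)) = ((g *m h^T) 0 0)%:E)%E.
  rewrite integralZl//; last by apply: integrableB => //; exact: integrable_lin_sqr.
  rewrite integralB//; try exact: integrable_lin_sqr.
  rewrite !integral_lin_sqr -EFinB -EFinM; congr EFin.
  rewrite [(g + h)^T]linearD [(g - h)^T]linearB /= !(mulmxDl, mulmxBl).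
  rewrite !(mulmxDr, mulmxBr) !(mulNmx, mulmxN) !mxE.
  have -> : \sum_j h 0 j * g^T j 0 = \sum_j g 0 j * h^T j 0.
    by apply: eq_bigr => j _; rewrite !mxE mulrC.
  by field.
rewrite -E; apply: eq_integral => w _; rewrite -EFinB -EFinM; congr EFin.
rewrite mulmxDl mulmxBl !mxE; by field.
Qed.

Lemma integrable_coord (j : 'I_m) : P.-integrable setT (EFin \o Z j).
Proof.
have mZ : measurable_fun setT (EFin \o Z j) by apply/measurable_EFinP; exact: measurable_funP.
have zE w : (delta_mx 0 j *m z w) 0 0 = Z j w.
  rewrite mxE (bigD1 j)//= !mxE !eqxx mul1r big1 ?addr0// => l lj.
  by rewrite !mxE (negPf lj) andbF mul0r.
apply: (@le_integrable _ _ _ P setT measurableT _ (fun w => (1 + ((delta_mx 0 j *m z w) 0 0) ^+ 2)%:E)) => //.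
  move=> w _; rewrite /= lee_fin zE.
  rewrite [leRHS]ger0_norm ?addr_ge0 ?sqr_ge0//.
  rewrite ler_norml; apply/andP; split; nra.
under eq_fun do rewrite EFinD.
apply: integrableD => //; last exact: integrable_lin_sqr.
exact: finite_measure_integrable_cst.
Qed.

Lemma integral_coord (j : 'I_m) : (\int[P]_w (Z j w)%:E = 0)%E.
Proof.
rewrite integralE.
have law (f : R -> \bar R) : measurable_fun setT f -> (forall x, 0 <= f x)%E ->
    (\int[P]_w f (Z j w) = \int[normal_prob 0 1]_x f x)%E.
  move=> mf f0.
  have mphi : measurable_fun setT (Z j : T -> measurableTypeR R).
    exact: (measurable_funP (Z j)).
  have := @ge0_integral_pushforward _ _ _ _ R _ mphi P setT f measurableT mf.
  rewrite preimage_setT => <-; last by move=> x _; exact: f0.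
  apply: eq_measure_integral => A mA _; rewrite /= /pushforward; exact: (stdZ.2 j A mA).
pose f (x : R) : \bar R := (Num.max x 0)%:E.
have mf : measurable_fun setT f by apply/measurable_EFinP; exact: measurable_maxr.
have f0 x : (0 <= f x)%E by rewrite lee_fin le_max lexx orbT.
have -> : (\int[P]_w (fun w => (Z j w)%:E)^\+ w = \int[normal_prob 0 1]_x f x)%E.
  by rewrite -law//; apply: eq_integral => w _; rewrite /f funeposE EFin_max.
have -> : (\int[P]_w (fun w => (Z j w)%:E)^\- w = \int[normal_prob 0 1]_x f x)%E.
  rewrite -ge0_integral_normal_probN// -law//.
  - by apply: eq_integral => w _; rewrite /f funenegE EFin_max EFinN.
  - by apply: (measurableT_comp mf); exact: oppr_measurable.
have : (\int[normal_prob 0 1]_x f x \is a fin_num)%E.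
  rewrite -law//.
  have /integrable_funepos := integrable_coord j.
  move=> /(_ measurableT) /integrable_fin_num => /(_ measurableT).
  by congr (_ \is a fin_num); apply: eq_integral => w _; rewrite /f funeposE EFin_max.
by move=> /subee.
Qed.
End StdNormal.
End Moments.

(** * Algebra of the least squares and residual matrices *)

Section OLSAlgebra.
Context {R : realType} (n k : nat) (X : 'M[R]_(n, k)).
Hypothesis rankX : \rank X = k.

Definition ols_mx : 'M[R]_(k, n) := invmx (X^T *m X) *m X^T.
Definition res_mx : 'M[R]_n := 1%:M - X *m ols_mx.

Lemma gram_unit : X^T *m X \in unitmx.
Proof.
rewrite -row_free_unit; apply: inj_row_free => v vG.
have H : v *m X^T = 0.
  apply: trmx_inj; rewrite trmx0; apply/eqP; apply: contraTT isT => /dotv_gt0.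
  by rewrite /dotv trmxK trmx_mul trmxK -mulmxA (mulmxA X^T) mulmxA vG mul0mx mxE ltxx.
have fX : row_free X^T by rewrite /row_free mxrank_tr rankX.
by apply/eqP; rewrite -(mulmx_free_eq0 _ fX) H.
Qed.

Lemma gram_inv_tr : (invmx (X^T *m X))^T = invmx (X^T *m X).
Proof. by rewrite trmx_inv trmx_mul trmxK. Qed.

Lemma ols_mxX : ols_mx *m X = 1%:M.
Proof. by rewrite /ols_mx -mulmxA mulVmx// gram_unit. Qed.

Lemma ols_mx_tr : ols_mx^T = X *m invmx (X^T *m X).
Proof. by rewrite /ols_mx trmx_mul trmxK gram_inv_tr. Qed.

Lemma ols_mx_gram : ols_mx *m ols_mx^T = invmx (X^T *m X).
Proof. by rewrite ols_mx_tr mulmxA ols_mxX mul1mx. Qed.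

Lemma res_mx_tr : res_mx^T = res_mx.
Proof. by rewrite /res_mx linearB /= trmx1 trmx_mul ols_mx_tr /ols_mx mulmxA. Qed.

Lemma ols_res_mx : ols_mx *m res_mx = 0.
Proof. by rewrite /res_mx mulmxBr mulmx1 mulmxA ols_mxX mul1mx subrr. Qed.

Lemma res_mx_idem : res_mx *m res_mx = res_mx.
Proof. by rewrite {1}/res_mx mulmxBl mul1mx -mulmxA ols_res_mx mulmx0 subr0. Qed.

Lemma res_mx_trace : \tr res_mx = n%:R - k%:R.
Proof. by rewrite /res_mx linearB /= mxtrace1 mxtrace_mulC ols_mxX mxtrace1. Qed.

(** The residual matrix is 1 - X B with B X = 1. Taking out 1 + c and exchanging X and
    B leaves a scalar k by k determinant. *)
Lemma det_1res_mx (c : R) : (k <= n)%N -> 0 <= c ->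
  \det (1%:M + c *: res_mx) = (1 + c) ^+ (n - k).
Proof.
move=> kn c0; have c1 : 1 + c != 0 by rewrite gt_eqF// ltr_pwDl.
have -> : 1%:M + c *: res_mx = (1 + c) *: (1%:M + X *m (- (c / (1 + c)) *: ols_mx)).
  rewrite /res_mx scalerBr scalerDr -scalemxAr scalerA mulrN mulrC divfK// scaleNr.
  by rewrite addrA scalerDl scale1r.
rewrite detZ det_1addC -scalemxAl ols_mxX.
have -> : 1%:M + - (c / (1 + c)) *: 1%:M = (1 + c)^-1%:M :> 'M[R]_k.
  rewrite scale_scalar_mx mulr1 -raddfD /=; congr _%:M; by field.
by rewrite det_scalar exprVn -expfB_cond ?(negPf c1)// add0n.
Qed.

Lemma ols_error (beta : 'cV[R]_k) (e : 'cV[R]_n) :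
  ols X (X *m beta + e) - beta = ols_mx *m e.
Proof.
rewrite /ols -/ols_mx mulmxDr mulmxA ols_mxX mul1mx.
by rewrite addrC addKr.
Qed.

Lemma residual_error (beta : 'cV[R]_k) (e : 'cV[R]_n) :
  residual X (X *m beta + e) = res_mx *m e.
Proof.
rewrite /residual.
have -> : ols X (X *m beta + e) = beta + ols_mx *m e by rewrite -(ols_error beta e) [RHS]addrC subrK.
by rewrite mulmxDr opprD addrACA subrr add0r /res_mx mulmxBl mul1mx mulmxA.
Qed.

Lemma trace_gram_inv_gt0 : (0 < k)%N -> 0 < \tr (invmx (X^T *m X)).
Proof.
move=> k0; have G := gram_unit.
rewrite -ols_mx_gram.
have rowE i : (ols_mx *m ols_mx^T) i i = dotv (row i ols_mx)^T (row i ols_mx)^T.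
  by rewrite /dotv trmxK !mxE; apply: eq_bigr => j _; rewrite !mxE.
rewrite /mxtrace (bigD1 (Ordinal k0))//=.
rewrite ltr_pwDl//; last by apply: sumr_ge0 => i _; rewrite rowE dotv_ge0.
rewrite rowE dotv_gt0//; apply/eqP => /(congr1 trmx); rewrite trmxK trmx0 => r0.
have := congr1 (row (Ordinal k0)) ols_mxX; rewrite row_mul r0 mul0mx.
move=> /(congr1 (fun u : 'rV_k => u 0 (Ordinal k0))).
by rewrite !mxE eqxx => /esym/eqP; rewrite oner_eq0.
Qed.

Lemma trace_eigen (A : 'M[R]_k) (lambda : 'I_k -> R) : (0 < k)%N ->
  char_poly A = \prod_(i < k) ('X - (lambda i)%:P) -> \tr A = \sum_(i < k) lambda i.
Proof.
move=> k0 E; have := char_poly_trace A k0; rewrite E.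
have -> : \prod_(i < k) ('X - (lambda i)%:P) = \prod_(p <- [seq lambda i | i <- enum 'I_k]) ('X - p%:P).
  by rewrite big_map big_enum.
have sz : size [seq lambda i | i <- enum 'I_k] = k by rewrite size_map size_enum_ord.
have := @coefPn_prod_XsubC _ [seq lambda i | i <- enum 'I_k].
rewrite sz => ->; last by rewrite -lt0n.
by move=> /oppr_inj <-; rewrite big_map big_enum.
Qed.
End OLSAlgebra.

(** * Centred normal vectors with a scalar covariance matrix *)

Section NormalModel.
Context {R : realType} d (T : measurableType d) (P : probability T R).

Lemma integral_lin m (Z : 'I_m -> {RV P >-> R}) (a : 'rV[R]_m) (c : R) :
  std_normal Z ->
  (\int[P]_w (c + (a *m random_vector Z w) 0 0)%:E = c%:E)%E.
Proof.
move=> stdZ.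
have iZ j : P.-integrable setT (fun w => ((a 0 j)%:E * (Z j w)%:E)%E).
  by apply: integrableZl => //; exact: integrable_coord.
have E w : ((c + (a *m random_vector Z w) 0 0)%:E = cst c%:E w + \sum_j (a 0 j)%:E * (Z j w)%:E)%E.
  rewrite EFinD mxE -sumEFin; congr (_ + _)%E.
  by apply: eq_bigr => j _; rewrite mxE EFinM.
under eq_integral do rewrite E.
rewrite integralD//; last 2 first.
- exact: finite_measure_integrable_cst.
- by apply: integrable_sum.
rewrite integral_cst//= probability_setT mule1 integral_sum//.
rewrite big1 ?adde0// => j _.
rewrite integralZl//; last exact: integrable_coord.
by rewrite integral_coord// mule0.
Qed.

(** The prescribed first moments force the shift to vanish, the second moments force
    A A^T to be scalar. *)
Lemma normal_whitening n (eps : 'I_n -> {RV P >-> R}) (v : R) :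
  normal_vector eps ->
  (forall i, 'E_P[eps i] = 0)%E ->
  (forall i j, covariance P (eps i) (eps j) = (v%:M i j : R)%:E) ->
  exists m (A : 'M[R]_(n, m)) (Z : 'I_m -> {RV P >-> R}),
    [/\ std_normal Z, A *m A^T = v%:M &
      {ae P, forall w, random_vector eps w = A *m random_vector Z w}].
Proof.
move=> [m [mu [A [Z [/standard_normal_vector_std stdZ aeZ]]]]] Emean Ecov.
have mlin : measurable_mx (fun w => A *m random_vector Z w) by exact: measurable_mx_lin.
have rowE (i : 'I_n) w : (A *m random_vector Z w) i 0 = (row i A *m random_vector Z w) 0 0.
  by rewrite -row_mul [in RHS]mxE.
have mu0 : mu = 0.
  apply/colP => i; rewrite mxE.
  have := Emean i; rewrite expectation_def.
  rewrite (@ae_eq_integral _ _ _ P setT (fun w => (mu i 0 + (row i A *m random_vector Z w) 0 0)%:E))//.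
  - by rewrite integral_lin// => -[].
  - by apply/measurable_EFinP; exact: measurable_funP.
  - by apply/measurable_EFinP; apply: measurable_funD => //; exact: measurable_mx_lin.
  - apply: filterS aeZ => w E _.
    have -> : eps i w = random_vector eps w i 0 by rewrite mxE.
    by rewrite E mxE rowE.
have aeA : {ae P, forall w, random_vector eps w = A *m random_vector Z w}.
  by apply: filterS aeZ => w ->; rewrite mu0 add0r.
exists m, A, Z; split => //.
apply/matrixP => i j; apply/EFin_inj; rewrite -Ecov covariance.unlock !Emean /=.
rewrite expectation.unlock.
rewrite (@ae_eq_integral _ _ _ P setT
  (fun w => ((row i A *m random_vector Z w) 0 0 * (row j A *m random_vector Z w) 0 0)%:E))//.
- rewrite integral_linM//; congr EFin; rewrite !mxE; apply: eq_bigr => l _.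
  by rewrite !mxE.
- apply/measurable_EFinP; apply: measurable_funM; apply: measurable_funB => //; exact: measurable_funP.
- by apply/measurable_EFinP; apply: measurable_funM; exact: measurable_mx_lin.
- apply: filterS aeA => w E _.
  have Ei l : eps l w = (row l A *m random_vector Z w) 0 0.
    by rewrite -rowE -E mxE.
  by rewrite -!Ei /= -[((_ * _) w)]/((eps i w - 0) * (eps j w - 0)) !subr0.
Qed.

End NormalModel.

(** * Independence of least squares error and residual *)

Section Whitened.
Context {R : realType} d (T : measurableType d) (P : probability T R).
Variables (n k : nat) (X : 'M[R]_(n, k)).
Hypotheses (k_ge1 : (1 <= k)%N) (k_lt_n : (k < n)%N) (rankX : \rank X = k).
Variables (v : R) (v0 : 0 < v) (m : nat) (A : 'M[R]_(n, m)) (Z : 'I_m -> {RV P >-> R}).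
Hypotheses (stdZ : std_normal Z) (AA : A *m A^T = v%:M).
Let eps w := A *m random_vector Z w.

Lemma whitened_sqr p (K : 'M[R]_(p, n)) :
  (\int[P]_w (dotv (K *m eps w) (K *m eps w))%:E = (v * \tr (K *m K^T))%:E)%E.
Proof.
transitivity (\int[P]_w (dotv ((K *m A) *m random_vector Z w) ((K *m A) *m random_vector Z w))%:E)%E.
  by apply: eq_integral => w _; rewrite mulmxA.
rewrite integral_dotv_lin//; congr EFin.
by rewrite trmx_mul mulmxA -(mulmxA K) AA mul_mx_scalar -scalemxAl linearZ.
Qed.

Lemma measurable_dotv_lin p (K : 'M[R]_(p, n)) :
  measurable_fun setT (fun w => dotv (K *m eps w) (K *m eps w)).
Proof.
have mK : measurable_mx (fun w => K *m eps w).
  apply: measurable_mx_mul; first exact: measurable_mx_cst.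
  exact: measurable_mx_lin.
by apply: measurable_mx_mul => //; exact: measurable_mx_tr.
Qed.

(** The orthogonality g Q = 0 makes the joint Laplace transform of the two squares
    factor into powers with exponents - 1/2 and - (n - k)/2, the transforms of
    Gamma-distributed variables. *)
Lemma whitened_abs_norm (g : 'rV[R]_n) (l : R) :
  0 < l -> g *m g^T = l%:M -> g *m res_mx X = 0 ->
  (\int[P]_w (`|(g *m eps w) 0 0| *
     Num.sqrt (dotv (res_mx X *m eps w) (res_mx X *m eps w)))%:E =
   (v * Num.sqrt l / Num.sqrt pi * (n%:R - k%:R) *
      (Gamma ((n%:R - k%:R + 1) / 2) / Gamma ((n%:R - k%:R + 2) / 2)))%:E)%E.
Proof.
move=> l0 gg gQ; set Q := res_mx X in gQ *.
(* Half-integers are written j.+1 / 2, which keeps them positive. *)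
set j := (n - k).-1.
have jE : (n - k)%N = j.+1 by rewrite /j prednK// subn_gt0.
have jR : n%:R - k%:R = j.+1%:R :> R by rewrite -natrB ?(ltnW k_lt_n)// jE.
pose p w := ((g *m eps w) 0 0) ^+ 2.
pose q w := dotv (Q *m eps w) (Q *m eps w).
have mp : measurable_fun setT p.
  apply: measurable_funX; apply: measurable_mx_mul; first exact: measurable_mx_cst.
  exact: measurable_mx_lin.
have mq : measurable_fun setT q by exact: measurable_dotv_lin.
have p0 w : 0 <= p w by exact: sqr_ge0.
have q0 w : 0 <= q w by exact: dotv_ge0.
have vl0 : 0 < 2 * (v * l) by rewrite !mulr_gt0.
have v20 : 0 < 2 * v by rewrite mulr_gt0.
pose phi s := (1 + 2 * (v * l) * s) `^ (- (1%:R / 2)).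
pose psi s := (1 + 2 * v * s) `^ (- (j.+1%:R / 2)).
have Hpq (s t : R) : 0 <= s -> 0 <= t ->
    (\int[P]_w (expR (- (s * p w + t * q w)%R))%:E = (phi s * psi t)%:E)%E.
  move=> s0 t0.
  have gH : (g *m A) *m (Q *m A)^T = 0.
    rewrite trmx_mul mulmxA -(mulmxA g) AA mul_mx_scalar -scalemxAl.
    by rewrite res_mx_tr gQ scaler0.
  have := integral_gauss_pair stdZ gH s0 t0.
  have -> : (g *m A *m (g *m A)^T) 0 0 = v * l.
    rewrite trmx_mul mulmxA -(mulmxA g) AA mul_mx_scalar -scalemxAl gg.
    by rewrite scale_scalar_mx mxE eqxx mulr1n.
  have -> : 1%:M + (2 * t) *: (Q *m A *m (Q *m A)^T) = 1%:M + (2 * v * t) *: Q.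
    rewrite trmx_mul mulmxA -(mulmxA Q) AA mul_mx_scalar -scalemxAl.
    by rewrite res_mx_tr res_mx_idem// scalerA; congr (_ + _ *: _); ring.
  rewrite det_1res_mx//; [|exact: ltnW|by rewrite !mulr_ge0// ltW].
  move=> E; transitivity ((Num.sqrt (1 + 2 * s * (v * l)))^-1 *
    (Num.sqrt ((1 + 2 * v * t) ^+ (n - k)))^-1)%:E.
    by rewrite -E; apply: eq_integral => w _; rewrite /p /q /eps !mulmxA.
  congr (_ * _)%:E; rewrite /phi /psi powRN.
    rewrite mul1r powR12_sqrt; last by rewrite addr_ge0// mulr_ge0// ltW.
    by congr (Num.sqrt _)^-1; ring.
  have t1 : 0 <= 1 + 2 * v * t by rewrite addr_ge0// mulr_ge0// ltW.
  rewrite powRrM powR12_sqrt; last exact: powR_ge0.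
  by rewrite powR_mulrn// jE.
have phi0 : phi 0 = 1 by rewrite /phi mulr0 addr0 powR1.
have psi0 : psi 0 = 1 by rewrite /psi mulr0 addr0 powR1.
have Ep := @expectation_sqrt R _ _ P p (2 * (v * l)) 0 p0 mp vl0.
have Eq := @expectation_sqrt R _ _ P q (2 * v) j q0 mq v20.
transitivity (\int[P]_w (Num.sqrt (p w) * Num.sqrt (q w))%:E)%E.
  by apply: eq_integral => w _; rewrite sqrtr_sqr.
have [G1 _] := @Gamma_half_int R 0.
have [G2 _] := @Gamma_half_int R 1.
have Eq' : (\int[P]_w (Num.sqrt (q w))%:E =
    (Num.sqrt (2 * v) * Gamma (j.+2%:R / 2) / Gamma (j.+1%:R / 2))%:E)%E.
  apply: Eq => s s0; have := Hpq 0 s (lexx _) s0; rewrite phi0 mul1r => <-.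
  by apply: eq_integral => w _; rewrite mul0r add0r.
have Ep' : (\int[P]_w (Num.sqrt (p w))%:E =
    (Num.sqrt (2 * (v * l)) * Gamma (2%:R / 2) / Gamma (1%:R / 2))%:E)%E.
  apply: Ep => s s0; have := Hpq s 0 s0 (lexx _); rewrite psi0 mulr1 => <-.
  by apply: eq_integral => w _; rewrite mul0r addr0.
rewrite (expectation_sqrtM p0 mp q0 mq Hpq phi0 psi0 _ Ep'); last first.
  apply: divr_ge0; last exact: ltW.
  by apply: mulr_ge0; [exact: sqrtr_ge0|exact: ltW].
rewrite Eq' -EFinM; congr EFin.
have -> : Gamma (1%:R / 2) = Num.sqrt pi :> R by rewrite Gamma_egamma mul1r egamma_half.
have -> : Gamma (2%:R / 2) = 1 :> R by rewrite Gamma_egamma divff// egamma1.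
rewrite jR natr1 -[j.+1%:R + 2]natrD addn2.
have -> : j.+3%:R / 2 = j.+1%:R / 2 + 1 :> R.
  by rewrite -[j.+3]addn2 natrD; field.
have [G3 _] := @Gamma_half_int R j.
rewrite Gamma_half_intD1.
have -> : 2 * (v * l) = (2 * v) * l by ring.
rewrite (sqrtrM _ (ltW v20)).
have sv : Num.sqrt (2 * v) * Num.sqrt (2 * v) = 2 * v by rewrite -expr2 sqr_sqrtr ?ltW.
rewrite [LHS](_ : _ = (Num.sqrt (2 * v) * Num.sqrt (2 * v)) * Num.sqrt l / Num.sqrt pi *
   (Gamma (j.+2%:R / 2) / Gamma (j.+1%:R / 2))); last by ring.
rewrite sv; field.
by rewrite gt_eqF// nat1r pnatr_eq0 sqrtr_eq0 -ltNge pi_gt0.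
Qed.

End Whitened.

(** * The mean squared errors *)

Lemma sign_mul_norm {R : realType} (x : R) : sign x * x = `|x|.
Proof.
rewrite /sign; case: ifPn => x0; first by rewrite mul1r ger0_norm.
by rewrite mulN1r ltr0_norm// ltNge.
Qed.

Lemma sign_sqr {R : realType} (x : R) : sign x ^+ 2 = 1.
Proof. by rewrite /sign; case: ifPn; rewrite ?sqrrN expr1n. Qed.

Lemma dotvBZ {R : realType} k (u z : 'cV[R]_k) (a : R) : dotv z z = 1 ->
  dotv (u - a *: z) (u - a *: z) = dotv u u - 2 * (a * dotv z u) + a ^+ 2.
Proof.
move=> zz.
have uz : dotv u z = dotv z u.
  by rewrite !dotvE; apply: eq_bigr => i _; rewrite mulrC.
have -> : dotv (u - a *: z) (u - a *: z) = dotv u u - a * dotv u z - a * dotv z u + a * (a * dotv z z).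
  rewrite /dotv [(u - _)^T]linearB /= [(a *: z)^T]linearZ /= mulmxBl !mulmxBr -!scalemxAl -!scalemxAr !mxE.
  by ring.
by rewrite uz zz; ring.
Qed.

Lemma measurable_dotv {R : realType} d (T : measurableType d) n (f g : T -> 'cV[R]_n) :
  measurable_mx f -> measurable_mx g -> measurable_fun setT (fun w => dotv (f w) (g w)).
Proof. by move=> mf mg; apply: measurable_mx_mul => //; exact: measurable_mx_tr. Qed.

Theorem mainTheorem4 (R : realType) (d : measure_display)
    (T : measurableType d) (P : probability T R)
    (n k : nat) (k_ge1 : (1 <= k)%N) (k_lt_n : (k < n)%N)
    (X : 'M[R]_(n, k)) (rankX : \rank X = k)
    (beta : 'cV[R]_k) (sigma : R) (sigma2_gt0 : 0 < sigma ^+ 2)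
    (eps : 'I_n -> {RV P >-> R})
    (eps_normal : normal_vector eps)
    (eps_mean : forall i : 'I_n, ('E_P[eps i] = 0)%E)
    (eps_cov : forall i j : 'I_n,
       covariance P (eps i) (eps j) = ((sigma ^+ 2)%:M i j : R)%:E)
    (Y : T -> 'cV[R]_n)
    (Y_model : forall w : T, Y w = X *m beta + random_vector eps w)
    (lambda : 'I_k -> R)
    (lambda_eigen :
       char_poly (invmx (X^T *m X)) = \prod_(i < k) ('X - (lambda i)%:P))
    (lambda1 : R) (lambda1E : lambda1 = lambda (Ordinal k_ge1))
    (lambda1_max : forall i : 'I_k, lambda i <= lambda1)
    (z1 : 'cV[R]_k) (z1_normalized : dotv z1 z1 = 1)
    (z1_eigen : invmx (X^T *m X) *m z1 = lambda1 *: z1) :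
  (mse P (fun w => btilde_o X beta lambda1 z1 (Y w)) beta
     / mse P (fun w => ols X (Y w)) beta)%E =
  (1 - (n%:R - k%:R) / pi *
       (Gamma ((n%:R - k%:R + 1) / 2) ^+ 2 /
        Gamma ((n%:R - k%:R + 2) / 2) ^+ 2) *
       (lambda1 / \sum_(i < k) lambda i))%:E.
Proof.
have [m [A [Z [stdZ AA aeZ]]]] := normal_whitening eps_normal eps_mean eps_cov.
set v := sigma ^+ 2 in sigma2_gt0 AA *.
set B := ols_mx X; set Q := res_mx X.
have trN := trace_eigen k_ge1 lambda_eigen.
rewrite -trN; set tr := \tr _.
have tr0 : 0 < tr by exact: trace_gram_inv_gt0.
(* Here z1^T delta = g eps; the row g is orthogonal to the residual space and
   has squared norm lambda1. *)
pose g : 'rV[R]_n := z1^T *m B.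
have gg : g *m g^T = lambda1%:M.
  rewrite /g trmx_mul trmxK mulmxA -(mulmxA _ B) ols_mx_gram// -mulmxA z1_eigen.
  rewrite -scalemxAr; apply/matrixP => i j; rewrite !ord1 mxE [in RHS]mxE eqxx mulr1n.
  by rewrite -[(_ *m _) 0 0]/(dotv z1 z1) z1_normalized mulr1.
have gQ : g *m Q = 0 by rewrite /g -mulmxA ols_res_mx// mulmx0.
have l0 : 0 < lambda1.
  have z10 : z1 != 0.
    by apply: contra_eq_neq z1_normalized => ->; rewrite /dotv mulmx0 mxE eq_sym oner_eq0.
  have l1 : 0 <= lambda1.
    have -> : lambda1 = dotv g^T g^T by rewrite /dotv trmxK gg mxE eqxx mulr1n.
    exact: dotv_ge0.
  rewrite lt_neqAle l1 andbT eq_sym; apply: contra_neq z10 => l10.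
  by rewrite -[z1](mulKmx (gram_unit rankX)) -[z1](mulKVmx (gram_unit rankX)) z1_eigen l10 scale0r !mulmx0.
pose e w := random_vector eps w.
have meps : measurable_mx e by exact: measurable_random_vector.
have delta w : ols X (Y w) - beta = B *m e w by rewrite Y_model ols_error.
have resid w : residual X (Y w) = Q *m e w by rewrite Y_model residual_error.
have mK p (K : 'M[R]_(p, n)) (f : T -> 'cV[R]_n) : measurable_mx f ->
    measurable_mx (fun w => K *m f w).
  by move=> mf; apply: measurable_mx_mul => //; exact: measurable_mx_cst.
have mN p (K : 'M[R]_(p, n)) (f : T -> 'cV[R]_n) : measurable_mx f ->
    measurable_fun setT (fun w => dotv (K *m f w) (K *m f w)).
  by move=> mf; apply: measurable_dotv; exact: mK.
have transfer (F : 'cV[R]_n -> R) :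
    (forall f : T -> 'cV[R]_n, measurable_mx f -> measurable_fun setT (fun w => F (f w))) ->
    (forall u, 0 <= F u) ->
    (\int[P]_w (F (e w))%:E = \int[P]_w (F (A *m random_vector Z w))%:E)%E.
  move=> mF F0; apply: ge0_ae_eq_integral => //.
  - by apply/measurable_EFinP; exact: mF.
  - by apply/measurable_EFinP; apply: mF; exact: measurable_mx_lin.
  - by move=> w _; rewrite lee_fin.
  - by move=> w _; rewrite lee_fin.
  - by apply: filterS aeZ => w E _; rewrite /e E.
have I1 : (\int[P]_w (dotv (B *m e w) (B *m e w))%:E = (v * tr)%:E)%E.
  rewrite (transfer (fun u => dotv (B *m u) (B *m u)))//.
  - by rewrite (whitened_sqr stdZ AA) ols_mx_gram.
  - by move=> f; exact: mN.
  - by move=> u; exact: dotv_ge0.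
have I2 : (\int[P]_w (dotv (Q *m e w) (Q *m e w))%:E = (v * (n%:R - k%:R))%:E)%E.
  rewrite (transfer (fun u => dotv (Q *m u) (Q *m u)))//.
  - by rewrite (whitened_sqr stdZ AA) res_mx_tr// res_mx_idem// res_mx_trace.
  - by move=> f; exact: mN.
  - by move=> u; exact: dotv_ge0.
pose G : R := Gamma ((n%:R - k%:R + 1) / 2) / Gamma ((n%:R - k%:R + 2) / 2).
have mcross (f : T -> 'cV[R]_n) : measurable_mx f -> measurable_fun setT (fun w =>
    `|(g *m f w) 0 0| * Num.sqrt (dotv (Q *m f w) (Q *m f w))).
  move=> mf; apply: measurable_funM; last by apply: measurable_fun_sqrt; exact: mN.
  by apply: measurableT_comp => //; exact: mK.
have I3 : (\int[P]_w (`|(g *m e w) 0 0| * Num.sqrt (dotv (Q *m e w) (Q *m e w)))%:E =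
    (v * Num.sqrt lambda1 / Num.sqrt pi * (n%:R - k%:R) * G)%:E)%E.
  rewrite (transfer (fun u => `|(g *m u) 0 0| * Num.sqrt (dotv (Q *m u) (Q *m u))))//.
  exact: whitened_abs_norm.
have G0 : 0 <= G.
  have jR : n%:R - k%:R = (n - k).-1.+1%:R :> R by rewrite prednK ?subn_gt0// natrB// ltnW.
  rewrite /G jR natr1 -[_ + 2]natrD addn2.
  by apply: divr_ge0; apply: ltW; exact: (Gamma_half_int _).1.
set kappa := Num.sqrt (lambda1 / pi) * G.
have kappa0 : 0 <= kappa by rewrite mulr_ge0.
have kappaE : kappa = Num.sqrt lambda1 / Num.sqrt pi * G by rewrite /kappa sqrtrM ?ltW// sqrtrV ?pi_ge0.
have mse_b : mse P (fun w => ols X (Y w)) beta = (v * tr)%:E.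
  by rewrite /mse expectation.unlock -I1; apply: eq_integral => w _; rewrite delta.
pose r w := Num.sqrt (dotv (Q *m e w) (Q *m e w)).
have r2 w : r w ^+ 2 = dotv (Q *m e w) (Q *m e w) by rewrite sqr_sqrtr// dotv_ge0.
have err w : btilde_o X beta lambda1 z1 (Y w) - beta =
    B *m e w - (sign ((g *m e w) 0 0) * kappa * r w) *: z1.
  rewrite /btilde_o resid delta addrAC delta; congr (_ - _ *: _).
  by rewrite /r /kappa /G /g /dotv -!mulmxA !mulrA.
pose sq w := dotv (btilde_o X beta lambda1 z1 (Y w) - beta)
                  (btilde_o X beta lambda1 z1 (Y w) - beta).
(* Moving the cross term to the left leaves nonnegative integrands only. *)
have sqE w : sq w + 2 * kappa * (`|(g *m e w) 0 0| * r w) =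
    dotv (B *m e w) (B *m e w) + kappa ^+ 2 * dotv (Q *m e w) (Q *m e w).
  rewrite /sq err dotvBZ// -r2 -sign_mul_norm.
  have -> : dotv z1 (B *m e w) = (g *m e w) 0 0 by rewrite /dotv /g mulmxA.
  set s := sign _; set a := (g *m _) 0 0.
  have s2 : s ^+ 2 = 1 by exact: sign_sqr.
  rewrite [(s * kappa * r w) ^+ 2](_ : _ = s ^+ 2 * (kappa ^+ 2 * r w ^+ 2)); last by ring.
  by rewrite s2; ring.
have sqE' w : sq w = dotv (B *m e w) (B *m e w) + kappa ^+ 2 * dotv (Q *m e w) (Q *m e w) -
    2 * kappa * (`|(g *m e w) 0 0| * r w) by rewrite -sqE addrK.
have msq : measurable_fun setT sq.
  rewrite (_ : sq = fun w => dotv (B *m e w) (B *m e w) + kappa ^+ 2 * dotv (Q *m e w) (Q *m e w) -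
    2 * kappa * (`|(g *m e w) 0 0| * r w)); last by apply/funext.
  apply: measurable_funB; last by apply: measurable_funM => //; exact: mcross.
  apply: measurable_funD; first exact: mN.
  by apply: measurable_funM => //; exact: mN.
have mse_bt : mse P (fun w => btilde_o X beta lambda1 z1 (Y w)) beta =
    (v * tr - kappa ^+ 2 * v * (n%:R - k%:R))%:E.
  rewrite /mse expectation.unlock -/(sq _).
  have k20 : 0 <= 2 * kappa by rewrite mulr_ge0.
  have : (\int[P]_w (sq w)%:E + (2 * kappa)%:E * \int[P]_w (`|(g *m e w) 0 0| * r w)%:E =
      \int[P]_w (dotv (B *m e w) (B *m e w))%:E +
      (kappa ^+ 2)%:E * \int[P]_w (dotv (Q *m e w) (Q *m e w))%:E)%E.
    have mB : measurable_fun setT (fun w => (dotv (B *m e w) (B *m e w))%:E).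
      by apply/measurable_EFinP; exact: mN.
    have mQ : measurable_fun setT (fun w => (dotv (Q *m e w) (Q *m e w))%:E).
      by apply/measurable_EFinP; exact: mN.
    have mC : measurable_fun setT (fun w => (`|(g *m e w) 0 0| * r w)%:E).
      by apply/measurable_EFinP; exact: mcross.
    have mS : measurable_fun setT (fun w => (sq w)%:E) by exact/measurable_EFinP.
    have B0 w : setT w -> (0 <= (dotv (B *m e w) (B *m e w))%:E)%E.
      by move=> _; rewrite lee_fin dotv_ge0.
    have Q0 w : setT w -> (0 <= (dotv (Q *m e w) (Q *m e w))%:E)%E.
      by move=> _; rewrite lee_fin dotv_ge0.
    have C0 w : setT w -> (0 <= (`|(g *m e w) 0 0| * r w)%:E)%E.
      by move=> _; rewrite lee_fin; apply: mulr_ge0; [exact: normr_ge0|exact: sqrtr_ge0].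
    have S0 w : setT w -> (0 <= (sq w)%:E)%E by move=> _; rewrite lee_fin dotv_ge0.
    have mZ c (h : T -> \bar R) : measurable_fun setT h ->
        measurable_fun setT (fun w => (c%:E * h w)%E).
      by move=> mh; apply: emeasurable_funM => //; exact: measurable_cst.
    have Z0 c (h : T -> \bar R) : (0 <= c)%R -> (forall w, setT w -> (0 <= h w)%E) ->
        forall w, setT w -> (0 <= c%:E * h w)%E.
      by move=> c0 h0 w Tw; rewrite mule_ge0// h0.
    have k2 := sqr_ge0 kappa.
    rewrite -(ge0_integralZl _ measurableT mC C0)// -(ge0_integralZl _ measurableT mQ Q0)//.
    rewrite -(ge0_integralD _ measurableT S0 mS (Z0 _ _ k20 C0) (mZ _ _ mC)).
    rewrite -(ge0_integralD _ measurableT B0 mB (Z0 _ _ k2 Q0) (mZ _ _ mQ)).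
    by apply: eq_integral => w _; rewrite -!EFinM -!EFinD sqE.
  rewrite I1 I2 I3 -!EFinM -EFinD.
  set c := 2 * kappa * _ => /(congr1 (fun x : \bar R => (x - c%:E)%E)).
  rewrite addeK// => ->; rewrite -EFinB; congr EFin.
  by rewrite /c kappaE; ring.
rewrite mse_b mse_bt.
rewrite inver gt_eqF; last exact: (mulr_gt0 sigma2_gt0 tr0).
rewrite -EFinM; congr EFin.
have k2 : kappa ^+ 2 = lambda1 / pi * G ^+ 2.
  by rewrite exprMn sqr_sqrtr// divr_ge0 ?pi_ge0// ltW.
rewrite k2 -expr_div_n -/G.
have ratio (a b p G' l D : R) : a != 0 -> b != 0 -> p != 0 ->
    (a * b - l / p * G' * a * D) / (a * b) = 1 - D / p * G' * (l / b).
  by move=> a0 b0 p0; field; rewrite a0 b0 p0.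
by apply: ratio; rewrite gt_eqF ?pi_gt0.
Qed.
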